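(* Let $\Gamma$ be a discrete group and $1\le p\le\infty$. Let $(\Phi_t)_{t\ge0}$ be a quantum Markov semi-group on the group von Neumann algebra $(\mathcal{L}(\Gamma),\tau)$ with generator $\Delta$, and assume that $\mathbb{C}[\Gamma]$ is contained in the domain of $\Delta$. Let $\Delta^\Psi$ be the generator of the averaged semi-group described in the context. If $(\Phi_t)_{t\ge0}$ is gradient-$\mathcal{S}_p$ then so is $(\exp(-t\Delta^\Psi))_{t\ge0}$.
   Context: $\mathcal{L}(\Gamma)$ carries its canonical trace $\tau$, $L_2(\mathcal{L}(\Gamma))=\ell_2(\Gamma)$, and group elements $\gamma\in\Gamma$ are identified both with the unitaries of the left regular representation and with basis vectors of $\ell_2(\Gamma)$; $\mathbb{C}[\Gamma]\subseteq\mathcal{L}(\Gamma)$ and $\mathbb{C}[\Gamma]\subseteq\ell_2(\Gamma)$ accordingly. A quantum Markov semi-group on $(M,\tau)$ is a semi-group $(\Phi_t)_{t\ge0}$ of unital completely positive maps $M\to M$ with $\tau\circ\Phi_t=\tau$ and $\tau(\Phi_t(x)y)=\tau(x\Phi_t(y))$ for $x,y\in M$, such that $t\mapsto\Phi_t(x)$ is strongly continuous for every $x\in M$. Its generator is the positive self-adjoint operator $\Delta\ge0$ on $L_2(M)$ with $\exp(-t\Delta)(x\Omega_\tau)=\Phi_t(x)\Omega_\tau$, where $\Omega_\tau$ is the vector of $1\in M$. Averaging. Let $\delta_\Gamma:\mathcal{L}(\Gamma)\to\mathcal{L}(\Gamma)\overline{\otimes}\mathcal{L}(\Gamma)$, $\gamma\mapsto\gamma\otimes\gamma$,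 be the comultiplication and let $\mathbb{E}$ be the trace preserving conditional expectation of $\mathcal{L}(\Gamma)\overline{\otimes}\mathcal{L}(\Gamma)$ onto the image of $\delta_\Gamma$, composed with $\delta_\Gamma^{-1}$. Put $\Psi_t=\mathbb{E}\circ(\Phi_t\otimes\mathrm{id})\circ\delta_\Gamma$, a completely positive Fourier multiplier with $\Psi_t(\gamma)=\tau(\Phi_t(\gamma)\gamma^{-1})\gamma$. Let $\Delta^\Psi$ be the closure of the operator on $\ell_2(\Gamma)$ with domain $\mathbb{C}[\Gamma]$ given by $\gamma\mapsto\lim_{t\searrow0}\frac1t(\gamma-\Psi_t(\gamma))$ (the limits exist as $\mathbb{C}[\Gamma]\subseteq\mathrm{Dom}(\Delta)$); explicitly $\Delta^\Psi(\gamma)=\langle\Delta(\gamma),\gamma\rangle\gamma$. Then $(\exp(-t\Delta^\Psi))_{t\ge0}$ is a quantum Markov semi-group of Fourier multipliers on $\mathcal{L}(\Gamma)$. Gradient-$\mathcal{S}_p$ (with respect to $\mathbb{C}[\Gamma]$). $\mathcal{S}_p$ is the Schatten class. A quantum Markov semi-group with generator $\Delta$ with $\mathbb{C}[\Gamma]\subseteq\mathrm{Dom}(\Delta)$ is gradient-$\mathcal{S}_p$ if for all $a,b\in\mathbb{C}[\Gamma]$ the map $x\mapsto-\frac12\big(\Delta(axb)+a\Delta(x)b-\Delta(ax)b-a\Delta(xb)\big)$, $x\in\mathbb{C}[\Gamma]$ (values in $\ell_2(\Gamma)$, with $a,b$ acting by left and right multiplication), extends to a bounded operator on $\ell_2(\Gamma)$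 that lies in $\mathcal{S}_p$. *)

(* Defs.v *)
From HB Require Import structures.
From mathcomp Require Import all_boot all_order all_algebra.
From mathcomp Require Import complex.
From mathcomp Require Import all_classical all_reals all_analysis.
From mathcomp Require Import ring.

Set Implicit Arguments.
Unset Strict Implicit.
Unset Printing Implicit Defensive.

Import Order.TTheory GRing.Theory Num.Theory.
Import numFieldNormedType.Exports.

Local Open Scope classical_set_scope.
Local Open Scope complex_scope.
Local Open Scope ring_scope.

Section HilbertSpace.
Context {R : realType} {I : choiceType}.

Definition sqmod (z : R[i]) : R := complex.Re z ^+ 2 + complex.Im z ^+ 2.

Definition square_summable : {pred I -> R[i]} :=
  fun f => `[< (\esum_(i in [set: I]) (sqmod (f i))%:E < +oo)%E >].

Lemma sqmod_ge0 z : 0 <= sqmod z.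
Proof. by rewrite addr_ge0 // sqr_ge0. Qed.

Lemma sqmod_lin (a u v : R[i]) :
  sqmod (a * u + v) <= (2 * sqmod a) * sqmod u + 2 * sqmod v.
Proof.
case: a u v => [a1 a2] [u1 u2] [v1 v2]; rewrite /sqmod /=.
rewrite -subr_ge0; set d := (X in 0 <= X).
have -> : d = (a1 * u1 - a2 * u2 - v1) ^+ 2 + (a1 * u2 + a2 * u1 - v2) ^+ 2.
  by rewrite /d; ring.
by rewrite addr_ge0 // sqr_ge0.
Qed.

Lemma square_summable_submod : submod_closed square_summable.
Proof.
split=> [|a u v /asboolP su /asboolP sv]; apply/asboolP.
  rewrite esum1 ?ltry// => i _.
  by rewrite /sqmod /= expr0n /= addr0.
have nn (c : R) (w : I -> R[i]) i : 0 <= c -> (0 <= (c * sqmod (w i))%:E)%E.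
  by move=> c0; rewrite lee_fin mulr_ge0 // sqmod_ge0.
have scl (c : R) (w : I -> R[i]) : 0 <= c ->
    (\esum_(i in [set: I]) (sqmod (w i))%:E < +oo)%E ->
    (\esum_(i in [set: I]) (c * sqmod (w i))%:E < +oo)%E.
  move=> c0 sw.
  have le1 : (\esum_(i in [set: I]) (c * sqmod (w i))%:E
      <= c%:E * \esum_(i in [set: I]) (sqmod (w i))%:E)%E.
    apply: ge_ereal_sup => _ [A [fA _] <-].
    under eq_fsbigr do rewrite EFinM.
    rewrite -ge0_mule_fsumr; last by move=> i; rewrite lee_fin sqmod_ge0.
    apply: lee_wpmul2l; first by rewrite lee_fin.
    by apply: esum_ge; exists A.
  apply: le_lt_trans le1 _.
  have : \esum_(i in [set: I]) (sqmod (w i))%:E \is a fin_num.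
    rewrite ge0_fin_numE //; apply: esum_ge0 => i _.
    by rewrite lee_fin sqmod_ge0.
  by move=> /fineK <-; rewrite -EFinM ltry.
have a0 : 0 <= 2 * sqmod a by rewrite mulr_ge0 // sqmod_ge0.
apply: (@le_lt_trans _ _ (\esum_(i in [set: I])
   ((2 * sqmod a * sqmod (u i))%:E + (2 * sqmod (v i))%:E))%E).
  by apply: le_esum => i _; rewrite -EFinD lee_fin sqmod_lin.
rewrite esumD; [|by move=> i _; exact: nn..].
by apply: lte_add_pinfty; apply: scl.
Qed.

HB.instance Definition _ :=
  GRing.isSubmodClosed.Build R[i] (I -> R[i]) square_summable
    square_summable_submod.

Record l2 := L2 { l2val :> I -> R[i]; _ : l2val \in square_summable }.
HB.instance Definition _ := [isSub for l2val].
HB.instance Definition _ := [Choice of l2 by <:].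
HB.instance Definition _ := [SubChoice_isSubLmodule of l2 by <:].


(* The vector with coordinates f; the default 0 for a family f that is not
   square summable is irrelevant wherever this is used below. *)
Definition mkl2 (f : I -> R[i]) : l2 := insubd 0 f.

(* Sum of an absolutely summable family of complex numbers over the possibly
   uncountable index set I. *)
Definition rsum (f : I -> R) : R :=
  fine (\esum_(i in [set: I]) (Num.max (f i) 0)%:E) -
  fine (\esum_(i in [set: I]) (Num.max (- f i) 0)%:E).
Definition csum (f : I -> R[i]) : R[i] :=
  rsum (fun i => complex.Re (f i)) +i* rsum (fun i => complex.Im (f i)).

(* Linear in the first variable. *)
Definition inner (u v : l2) : R[i] := csum (fun i => u i * conjc (v i)).

Definition l2norm (u : l2) : R :=
  Num.sqrt (fine (\esum_(i in [set: I]) (sqmod (u i))%:E)).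

Definition basis (i : I) : l2 := mkl2 (fun j => (j == i)%:R).

Definition op := l2 -> l2.

Definition bounded_op (T : op) : Prop :=
  linear T /\ exists M : R, forall u, l2norm (T u) <= M * l2norm u.

Definition positive_op (T : op) : Prop := forall u, 0 <= inner (T u) u.

Definition commutant (S : set op) : set op :=
  [set T | bounded_op T /\ forall x, S x -> T \o x = x \o T].

(* Double commutant: the von Neumann algebra generated by a set of bounded
   operators that is closed under adjoints. *)
Definition vN (S : set op) : set op := commutant (commutant S).

(* An unbounded operator is identified with its graph. *)
Definition uop := set (l2 * l2).

Definition dom (A : uop) : set l2 := [set u | exists v, A (u, v)].

(* The value at u of a single-valued A, for u in its domain. *)
Definition app (A : uop) (u : l2) : l2 := xget 0 [set v | A (u, v)].

Definition densely_defined (A : uop) : Prop :=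
  forall u (e : R), 0 < e -> exists2 v, dom A v & l2norm (u - v) < e.

Definition adjoint (A : uop) : uop :=
  [set w | forall u v, A (u, v) -> inner v w.1 = inner u w.2].

Definition positive_selfadjoint (A : uop) : Prop :=
  [/\ densely_defined A, adjoint A = A &
      forall u v, A (u, v) -> 0 <= inner v u].

Definition closure_uop (A : uop) : uop :=
  [set w | forall e : R, 0 < e ->
     exists u v, [/\ A (u, v), l2norm (u - w.1) < e & l2norm (v - w.2) < e]].

Definition orthogonal_projection (P : op) : Prop :=
  [/\ bounded_op P, P \o P = P & forall u v, inner (P u) v = inner u (P v)].

Definition half_line : set (measurableTypeR R) := [set` `[(0 : R), +oo[].

(* E is a projection-valued Borel measure on R carried by [0, +oo[, and mu u
   is the positive measure B |-> <E(B) u, u>. *)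
Definition spectral_measure (E : set R -> op)
    (mu : l2 -> {measure set (measurableTypeR R) -> \bar R}) : Prop :=
  [/\ forall B : set (measurableTypeR R), measurable B ->
        orthogonal_projection (E B),
      E setT = id,
      E (~` half_line) = (fun=> 0),
      forall A B : set (measurableTypeR R), measurable A -> measurable B ->
        E (A `&` B) = E A \o E B &
      forall (B : set (measurableTypeR R)) u, measurable B ->
        mu u B = (complex.Re (inner (E B u) u))%:E].

(* A = \int l dE(l); the quadratic form determines A on its domain by
   polarization. *)
Definition spectral_decomposition (A : uop) (E : set R -> op)
    (mu : l2 -> {measure set (measurableTypeR R) -> \bar R}) : Prop :=
  [/\ spectral_measure E mu,
      forall u, dom A u <->
        (\int[mu u]_(l in half_line) (l ^+ 2)%:E < +oo)%E &
      forall u v, A (u, v) ->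
        inner v u = (\int[mu u]_(l in half_line) l)%:C].

(* S = exp(- t A) in the Borel functional calculus of the positive
   self-adjoint operator A. *)
Definition is_exp (A : uop) (t : R) (S : op) : Prop :=
  bounded_op S /\
  exists E mu, spectral_decomposition A E mu /\
    forall u, inner (S u) u = (\int[mu u]_(l in half_line) expR (- t * l))%:C.

Definition orthonormal_on (D : set nat) (e : nat -> l2) : Prop :=
  forall m n, D m -> D n -> inner (e m) (e n) = (m == n)%:R.

(* S_p: the operators T = \sum_n s_n <., e_n> f_n with (e_n) and (f_n)
   orthonormal systems and singular values (s_n) in l_p; for p = +oo the
   singular values tend to 0, that is, S_oo is the class of compact operators.
   The sequence s is padded by zeros, at which e and f are irrelevant. *)
Definition schatten (p : \bar R) (T : op) : Prop :=
  bounded_op T /\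
  exists (s : nat -> R) (e f : nat -> l2),
    [/\ forall n, 0 <= s n,
        orthonormal_on [set n | s n != 0] e,
        orthonormal_on [set n | s n != 0] f,
        forall u, l2norm (T u - \sum_(0 <= n < N) ((s n)%:C * inner u (e n)) *: f n)
                    @[N --> \oo] --> 0 &
        match p with
        | p'%:E => (\sum_(0 <= n <oo) (s n `^ p')%:E < +oo)%E
        | +oo%E => s @ \oo --> 0
        | -oo%E => False
        end].

End HilbertSpace.
Arguments l2 R I : clear implicits.
Arguments op R I : clear implicits.
Arguments uop R I : clear implicits.

Section GroupVonNeumannAlgebra.
Context {R : realType} {G : groupType}.
Local Notation H := (l2 R G).
Local Notation H2 := (l2 R (G * G)%type).
Implicit Types (x y : op R G) (X Y : op R (G * G)%type).

Definition vec1 : H := basis 1%g.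

Definition lambda (s : G) : op R G := fun u => mkl2 (fun g => u (s^-1 * g)%g).

Definition LG : set (op R G) := vN (range lambda).

Definition tau x : R[i] := inner (x vec1) vec1.

(* l2(G) (x) l2(G) is realized as l2(G x G). *)

Definition slice (z : H2) (k : G) : H := mkl2 (fun g => z (g, k)).

Definition tensor_op x y : op R (G * G)%type := fun z =>
  mkl2 (fun q => y (mkl2 (fun h => x (slice z h) q.1)) q.2).

Definition LG2 : set (op R (G * G)%type) :=
  vN [set X | exists x y, [/\ LG x, LG y & X = tensor_op x y]].

Definition tau2 X : R[i] :=
  inner (X (basis (1%g, 1%g))) (basis (1%g, 1%g)).

(* The normal *-homomorphism with s |-> s (x) s for s in G. It is spatially
   implemented: l2(G x G) is the direct sum over k of the copies
   { (g, g k) | g in G } of l2(G), and x acts on each summand. *)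
Definition comult x : op R (G * G)%type := fun z =>
  mkl2 (fun q => x (mkl2 (fun g => z (g, g * q.1^-1 * q.2)%g)) q.1).

(* The matrix entry (id (x) <. e_k, e_h>)(X) of X over the second leg. *)
Definition block X (h k : G) : op R G := fun u =>
  mkl2 (fun g => X (mkl2 (fun q => if q.2 == k then u q.1 else 0)) (g, h)).

(* phi (x) id: phi applied to each matrix entry over the second leg; in
   particular x (x) y is mapped to phi(x) (x) y. *)
Definition amplify (phi : op R G -> op R G) X : op R (G * G)%type := fun z =>
  mkl2 (fun q => csum (fun k => phi (block X q.2 k) (slice z k) q.1)).

(* E = comult^-1 o E0, for E0 the trace preserving conditional expectation of
   L(G) (x) L(G) onto comult(L(G)). *)
Definition averaging_expectation (E : op R (G * G)%type -> op R G) : Prop :=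
  [/\ forall X, LG2 X -> LG (E X),
      forall (a : R[i]) X Y, LG2 X -> LG2 Y ->
        E (fun z => a *: X z + Y z) = (fun u => a *: E X u + E Y u),
      forall X, LG2 X -> positive_op X -> positive_op (E X),
      (forall x, LG x -> E (comult x) = x) /\
      (forall x y X, LG x -> LG y -> LG2 X ->
        E (comult x \o X \o comult y) = x \o E X \o y) &
      forall X, LG2 X -> tau (E X) = tau2 X].

Definition positive_mx (n : nat) (x : 'I_n -> 'I_n -> op R G) : Prop :=
  forall u : 'I_n -> H, 0 <= \sum_(i < n) \sum_(j < n) inner (x i j (u j)) (u i).

Definition completely_positive (phi : op R G -> op R G) : Prop :=
  forall (n : nat) (x : 'I_n -> 'I_n -> op R G),
    (forall i j, LG (x i j)) -> positive_mx x ->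
    positive_mx (fun i j => phi (x i j)).

Definition linear_on_LG (phi : op R G -> op R G) : Prop :=
  forall (a : R[i]) x y, LG x -> LG y ->
    phi (fun u => a *: x u + y u) = (fun u => a *: phi x u + phi y u).

(* Only the values of Phi t, t >= 0, on LG are relevant. Normality of Phi t is
   automatic from positivity and preservation of the faithful normal trace. *)
Record is_qms (Phi : R -> op R G -> op R G) : Prop := {
  qms_LG : forall t x, 0 <= t -> LG x -> LG (Phi t x);
  qms_linear : forall t, 0 <= t -> linear_on_LG (Phi t);
  qms_unital : forall t, 0 <= t -> Phi t id = id;
  qms_cp : forall t, 0 <= t -> completely_positive (Phi t);
  qms_trace : forall t x, 0 <= t -> LG x -> tau (Phi t x) = tau x;
  qms_symmetric : forall t x y, 0 <= t -> LG x -> LG y ->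
    tau (Phi t x \o y) = tau (x \o Phi t y);
  qms_0 : forall x, LG x -> Phi 0 x = x;
  qms_add : forall s t x, 0 <= s -> 0 <= t -> LG x ->
    Phi (s + t) x = Phi s (Phi t x);
  qms_continuous : forall x u t0, LG x -> 0 <= t0 ->
    l2norm (Phi t x u - Phi t0 x u) @[t --> within (fun t => 0 <= t) (nbhs t0)]
      --> 0
}.

Definition is_generator (Phi : R -> op R G -> op R G) (A : uop R G) : Prop :=
  positive_selfadjoint A /\
  forall t, 0 <= t -> exists S, is_exp A t S /\
    forall x, LG x -> S (x vec1) = Phi t x vec1.

(* C[G], as the finitely supported vectors of l2(G). *)
Definition CG : set H := [set a | finite_set [set g | a g != 0]].

Definition lmul (a u : H) : H := \sum_(s \in [set: G]) a s *: lambda s u.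

Definition rmul (u b : H) : H :=
  \sum_(s \in [set: G]) b s *: (mkl2 (fun g => u (g * s^-1)%g) : H).

Definition gradient_map (A : uop R G) (a b u : H) : H :=
  - (2^-1 : R[i]) *: (app A (rmul (lmul a u) b) + rmul (lmul a (app A u)) b
                      - rmul (app A (lmul a u)) b - lmul a (app A (rmul u b))).

Definition gradient_Sp (p : \bar R) (Phi : R -> op R G -> op R G) : Prop :=
  exists A : uop R G,
    [/\ is_generator Phi A, CG `<=` dom A &
        forall a b, CG a -> CG b ->
          exists T : op R G, schatten p T /\
            forall u, CG u -> T u = gradient_map A a b u].

Definition averaged (E : op R (G * G)%type -> op R G)
    (Phi : R -> op R G -> op R G) (t : R) x : op R G :=
  E (amplify (Phi t) (comult x)).

(* The linear operator with domain C[G] and g |-> lim (g - Psi_t(g)) / t. *)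
Definition pre_generator (Psi : R -> op R G -> op R G) : uop R G :=
  [set w | CG w.1 /\ exists d : G -> H,
     (forall g, l2norm ((t^-1)%:C *: (basis g - Psi t (lambda g) vec1) - d g)
                  @[t --> 0^'+] --> 0) /\
     w.2 = \sum_(g \in [set: G]) w.1 g *: d g].

Definition averaged_generator (E : op R (G * G)%type -> op R G)
    (Phi : R -> op R G -> op R G) : uop R G :=
  closure_uop (pre_generator (averaged E Phi)).

End GroupVonNeumannAlgebra.

(* Main.v *)
Require Import Defs.
From HB Require Import structures.
From mathcomp Require Import all_boot all_order all_algebra.
From mathcomp Require Import complex.
From mathcomp Require Import all_classical all_reals all_analysis.
From mathcomp Require Import measurable_realfun finmap ring lra.
Import Order.TTheory GRing.Theory Num.Theory.
Import numFieldNormedType.Exports.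
Set Implicit Arguments.
Unset Strict Implicit.
Unset Printing Implicit Defensive.
Local Open Scope classical_set_scope.
Local Open Scope complex_scope.
Local Open Scope ring_scope.

(** The generator of the averaged semigroup is the multiplier on C[G] with symbol
    psi(g) = <A g, g>, because the expectation compresses Phi_t(g) to its
    diagonal matrix coefficient and (1 - <Phi_t(g), g>) / t tends to <A g, g>.
    Hence the gradient of the averaged semigroup at group elements (s, r) maps
    g to d_g * sgr, where d_g = <T_{s,r} g, sgr> is a matrix coefficient of the
    corresponding gradient T_{s,r} of the given semigroup. Taking such a
    diagonal preserves compactness and p-summability, by Jensen's inequality for
    doubly substochastic weights.

    A general gradient is a finite linear combination of these weighted shifts.
    To see that it is again in S_p, call an operator p-summable if
    sum_n |<X x_n, y_n>|^p is bounded over all orthonormal systems (x_n), (y_n).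
    This is stable under sums, and for a compact X the singular value
    decomposition (obtained by maximizing |X u| on the unit ball and deflating)
    turns it back into membership in S_p. *)

(** Diagonals are compatible with gradients because translations by group elements permute the
    basis: read from the basis vector at [s^-1 * g * r^-1] to the coordinate [g], each of the four
    terms of the gradient of A at (s, r) is a diagonal coefficient <A h, h>, which is exactly what
    averaging keeps. Off-diagonal entries of A never enter.

    Membership in S_p only asks for finiteness, so every p-summability bound may lose a constant
    such as 2^p, and convergent series can be cut to finite sums at the cost of a small error. The
    decomposition by maximization involves neither adjoints nor |X|, and the deflated operators are
    themselves the remainders of the series. For p = oo the same route is taken with compactness
    alone.

    The averaged generator is the closure of a graph, so no formula for its values comes with it.
    Being a generator it is positive self-adjoint, hence single-valued, and this identifies its
    values on C[G] with those of the multiplier. *)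

Local Notation Re := complex.Re.
Local Notation Im := complex.Im.
Local Notation basis := Defs.basis.

Arguments inner : simpl never.
Arguments csum : simpl never.

(** * Sums over arbitrary index sets *)

Section Sums.
Context {R : realType} {I : choiceType}.
Implicit Types (f g p q : I -> R) (h k : I -> R[i]).

Lemma esum_finP f (M : R) : (forall i, 0 <= f i) ->
  (forall s, uniq s -> \sum_(i <- s) f i <= M) ->
  (\esum_(i in [set: I]) (f i)%:E <= M%:E)%E.
Proof.
move=> f0 fM; apply: ge_ereal_sup => _ [A [fA _] <-].
rewrite fsbig_finite//= sumEFin lee_fin; apply: fM.
exact: fset_uniq.
Qed.

Lemma sum_le_esum f (s : seq I) : (forall i, 0 <= f i) -> uniq s ->
  ((\sum_(i <- s) f i)%:E <= \esum_(i in [set: I]) (f i)%:E)%E.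
Proof.
move=> f0 us; apply: esum_ge; exists [set` s]; first by split.
by rewrite -sumEFin fsbig_seq.
Qed.

Lemma esum_fin_num f (M : R) : (forall i, 0 <= f i) ->
  (\esum_(i in [set: I]) (f i)%:E <= M%:E)%E ->
  \esum_(i in [set: I]) (f i)%:E \is a fin_num.
Proof.
move=> f0 fM; rewrite ge0_fin_numE ?(le_lt_trans fM) ?ltry//.
by apply: esum_ge0 => i _; rewrite lee_fin.
Qed.

Lemma esumZ (c : R) f : 0 <= c -> (forall i, 0 <= f i) ->
  \esum_(i in [set: I]) (f i)%:E \is a fin_num ->
  \esum_(i in [set: I]) (c * f i)%:E = (c%:E * \esum_(i in [set: I]) (f i)%:E)%E.
Proof.
move=> c0 f0 ff.
have key d g : 0 <= d -> (forall i, 0 <= g i) ->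
    \esum_(i in [set: I]) (g i)%:E \is a fin_num ->
    (\esum_(i in [set: I]) (d * g i)%:E <= d%:E * \esum_(i in [set: I]) (g i)%:E)%E.
  move=> d0 g0 fg; rewrite -(fineK fg) -EFinM; apply: esum_finP => [i|s us].
    by rewrite mulr_ge0.
  rewrite -mulr_sumr ler_wpM2l// -lee_fin (fineK fg).
  exact: sum_le_esum.
have [->|cn0] := eqVneq c 0.
  by rewrite mul0e esum1// => i _; rewrite mul0r.
apply/le_anti/andP; split; first exact: key.
have cp : 0 < c by rewrite lt_def cn0.
have cf0 i : 0 <= c * f i by rewrite mulr_ge0.
have fcf : \esum_(i in [set: I]) (c * f i)%:E \is a fin_num.
  apply: (@esum_fin_num _ (c * fine (\esum_(i in [set: I]) (f i)%:E))) => //.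
  by rewrite EFinM (fineK ff); exact: key.
(* The reverse inequality is [key] for the factor [c^-1] and the family [c * f]. *)
have := @key c^-1 (fun i => c * f i); rewrite invr_ge0 => /(_ c0 cf0 fcf).
under eq_esum do rewrite mulrA mulVf// mul1r.
rewrite -(fineK fcf) -(fineK ff) -!EFinM !lee_fin => h.
by rewrite -(@ler_pM2l _ c^-1) ?invr_gt0// mulrA mulVf// mul1r.
Qed.

Lemma max_posneg (x : R) : Num.max x 0 = Num.max (- x) 0 + x.
Proof.
have /orP[x0|x0] := le_total 0 x; first by rewrite max_l// max_r ?oppr_le0// add0r.
by rewrite max_r// max_l ?oppr_ge0// addNr.
Qed.

Definition asummable f := \esum_(i in [set: I]) (`|f i|)%:E \is a fin_num.

Lemma esum_fin_le f g : (forall i, 0 <= f i) -> (forall i, f i <= g i) ->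
  \esum_(i in [set: I]) (g i)%:E \is a fin_num ->
  \esum_(i in [set: I]) (f i)%:E \is a fin_num.
Proof.
move=> f0 fg gf; apply: (@esum_fin_num _ (fine (\esum_(i in [set: I]) (g i)%:E))) => //.
by rewrite fineK//; apply: le_esum => i _; rewrite lee_fin.
Qed.

Lemma esum_finD f g : (forall i, 0 <= f i) -> (forall i, 0 <= g i) ->
  \esum_(i in [set: I]) (f i)%:E \is a fin_num ->
  \esum_(i in [set: I]) (g i)%:E \is a fin_num ->
  \esum_(i in [set: I]) (f i + g i)%:E \is a fin_num /\
  fine (\esum_(i in [set: I]) (f i + g i)%:E) =
  fine (\esum_(i in [set: I]) (f i)%:E) + fine (\esum_(i in [set: I]) (g i)%:E).
Proof.
move=> f0 g0 ff fg.
have -> : \esum_(i in [set: I]) (f i + g i)%:E =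
    (\esum_(i in [set: I]) (f i)%:E + \esum_(i in [set: I]) (g i)%:E)%E.
  under eq_esum do rewrite EFinD.
  by rewrite esumD// => i _; rewrite lee_fin.
by split; [rewrite fin_numD ff fg | rewrite fineD].
Qed.

Lemma asummable_parts f : asummable f ->
  \esum_(i in [set: I]) (Num.max (f i) 0)%:E \is a fin_num /\
  \esum_(i in [set: I]) (Num.max (- f i) 0)%:E \is a fin_num.
Proof.
move=> sf; split; apply: esum_fin_le sf => i; rewrite ?le_max ?lexx ?orbT//.
  by rewrite ge_max normr_ge0 ler_norm.
by rewrite ge_max normr_ge0 andbT -normrN ler_norm.
Qed.

(** Positive and negative parts are not additive, so [rsum] has to be freed from them. With f = p -
    q, the identity f^+ + q = p + f^- involves only non-negative families, whose sums do add. *)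
Lemma rsum_diff f p q : (forall i, 0 <= p i) -> (forall i, 0 <= q i) ->
  \esum_(i in [set: I]) (p i)%:E \is a fin_num ->
  \esum_(i in [set: I]) (q i)%:E \is a fin_num ->
  (forall i, f i = p i - q i) ->
  rsum f = fine (\esum_(i in [set: I]) (p i)%:E) - fine (\esum_(i in [set: I]) (q i)%:E).
Proof.
move=> p0 q0 sp sq fE.
have sf : asummable f.
  have [] := esum_finD p0 q0 sp sq.
  move=> + _; apply: esum_fin_le => // i; rewrite fE.
  by rewrite (le_trans (ler_normB _ _))// !ger0_norm.
have [sf1 sf2] := asummable_parts sf; rewrite /rsum.
have m0 (x : R) : 0 <= Num.max x 0 by rewrite le_max lexx orbT.
have m1 i : 0 <= Num.max (f i) 0 by [].
have m2 i : 0 <= Num.max (- f i) 0 by [].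
have [_ e1] := esum_finD m1 q0 sf1 sq; have [_ e2] := esum_finD p0 m2 sp sf2.
have e i : Num.max (f i) 0 + q i = p i + Num.max (- f i) 0.
  by rewrite max_posneg fE; lra.
move: e1; under eq_esum do rewrite e; rewrite e2 /rsum => e1.
by apply/eqP; rewrite subr_eq addrAC e1 addrK.
Qed.

Lemma asummableD f g : asummable f -> asummable g -> asummable (fun i => f i + g i).
Proof.
move=> sf sg; have [] := @esum_finD (fun i => `|f i|) (fun i => `|g i|)
  (fun=> normr_ge0 _) (fun=> normr_ge0 _) sf sg.
by move=> + _; apply: esum_fin_le => // i; exact: ler_normD.
Qed.

Lemma asummableZ (c : R) f : asummable f -> asummable (fun i => c * f i).
Proof.
move=> sf; rewrite /asummable; under eq_esum do rewrite normrM.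
by rewrite esumZ// fin_numM.
Qed.

Lemma rsumD f g : asummable f -> asummable g ->
  rsum (fun i => f i + g i) = rsum f + rsum g.
Proof.
move=> /asummable_parts [f1 f2] /asummable_parts [g1 g2].
have m0 (x : R) : 0 <= Num.max x 0 by rewrite le_max lexx orbT.
have [a1 a2] := @esum_finD (fun i => Num.max (f i) 0) (fun i => Num.max (g i) 0)
  (fun=> m0 _) (fun=> m0 _) f1 g1.
have [b1 b2] := @esum_finD (fun i => Num.max (- f i) 0) (fun i => Num.max (- g i) 0)
  (fun=> m0 _) (fun=> m0 _) f2 g2.
rewrite (@rsum_diff _ _ _ _ _ a1 b1).
- by rewrite a2 b2 /rsum; lra.
- by move=> i; rewrite addr_ge0.
- by move=> i; rewrite addr_ge0.
by move=> i; rewrite (max_posneg (f i)) (max_posneg (g i)); lra.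
Qed.

Lemma rsumN f : rsum (fun i => - f i) = - rsum f.
Proof. by rewrite /rsum opprB; under [X in _ - fine X]eq_esum do rewrite opprK. Qed.

Lemma rsumZ (c : R) f : asummable f -> rsum (fun i => c * f i) = c * rsum f.
Proof.
have key d g : 0 <= d -> asummable g -> rsum (fun i => d * g i) = d * rsum g.
  move=> d0 /asummable_parts [g1 g2]; rewrite /rsum mulrBr.
  have m0 (x : R) : 0 <= Num.max x 0 by rewrite le_max lexx orbT.
  have e (x : R) : Num.max (d * x) 0 = d * Num.max x 0.
    by rewrite maxr_pMr// mulr0.
  under eq_esum do rewrite e.
  under [X in _ - fine X]eq_esum do rewrite -mulrN e.
  by rewrite !esumZ// !fineM.
move=> sf; have [c0|/ltW c0] := lerP 0 c; first exact: key.
rewrite -[c]opprK mulNr -key// ?oppr_ge0// -rsumN; congr rsum.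
by apply/funext => i; rewrite mulNr.
Qed.

Lemma rsum_ge0E f : (forall i, 0 <= f i) ->
  rsum f = fine (\esum_(i in [set: I]) (f i)%:E).
Proof.
move=> f0; rewrite /rsum [X in _ - X](_ : _ = 0) ?subr0.
  by congr fine; apply: eq_esum => i _; rewrite max_l.
by rewrite esum1// => i _; rewrite max_r// oppr_le0.
Qed.

Lemma rsum_single f (i0 : I) : (forall i, i != i0 -> f i = 0) -> rsum f = f i0.
Proof.
move=> f0.
have e g : (forall i, 0 <= g i) -> (forall i, i != i0 -> g i = 0) ->
    fine (\esum_(i in [set: I]) (g i)%:E) = g i0.
  move=> g0 gz; have <- : fine (\esum_(i in [set i0]) (g i)%:E) = g i0.
    by rewrite esum_set1// lee_fin.
  congr fine; rewrite [RHS]esum_mkcond; apply: eq_esum => i _.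
  have [->|ne] := eqVneq i i0; first by rewrite mem_set.
  by rewrite memNset//= ?gz//; exact/eqP.
have m0 (x : R) : 0 <= Num.max x 0 by rewrite le_max lexx orbT.
rewrite /rsum (e (fun i => Num.max (f i) 0)) => [||i ne]; last 2 first.
- by move=> i.
- by rewrite f0// maxxx.
rewrite (e (fun i => Num.max (- f i) 0)) => [||i ne]; last 2 first.
- by move=> i.
- by rewrite f0// oppr0 maxxx.
by rewrite (max_posneg (f i0)); lra.
Qed.

Lemma csum_single h (i0 : I) : (forall i, i != i0 -> h i = 0) -> csum h = h i0.
Proof.
move=> h0; rewrite /csum !(@rsum_single _ i0); first by case: (h i0).
  by move=> i /h0 ->.
by move=> i /h0 ->.
Qed.

Definition csummable h := asummable (fun i => Re (h i)) /\ asummable (fun i => Im (h i)).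

Lemma csum_lin (a : R[i]) h k : csummable h -> csummable k ->
  csum (fun i => a * h i + k i) = a * csum h + csum k.
Proof.
case: a => x y [h1 h2] [k1 k2]; rewrite /csum.
have -> : (fun i => Re ((x +i* y) * h i + k i)) =
   (fun i => x * Re (h i) + (- y * Im (h i) + Re (k i))).
  by apply/funext => i; case: (h i) (k i) => [? ?] [? ?] /=; ring.
have -> : (fun i => Im ((x +i* y) * h i + k i)) =
   (fun i => x * Im (h i) + (y * Re (h i) + Im (k i))).
  by apply/funext => i; case: (h i) (k i) => [? ?] [? ?] /=; ring.
have Z (c : R) f (sf : asummable f) := asummableZ c sf.
have a1 := asummableD (Z (- y) _ h2) k1.
have a2 := asummableD (Z y _ h1) k2.
rewrite (rsumD (Z x _ h1) a1) (rsumD (Z x _ h2) a2).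
rewrite (rsumD (Z (- y) _ h2) k1) (rsumD (Z y _ h1) k2) !rsumZ//.
by apply/eqP; rewrite eq_complex /=; apply/andP; split; apply/eqP; ring.
Qed.

Lemma csum_conj h : csum (fun i => conjc (h i)) = conjc (csum h).
Proof.
rewrite /csum /=; congr (_ +i* _).
  by congr rsum; apply/funext => i; case: (h i).
by rewrite -rsumN; congr rsum; apply/funext => i; case: (h i).
Qed.

End Sums.

(** * The Hilbert space l2 *)

Section Complex.
Context {R : realType}.
Implicit Types z w : R[i].

Lemma sqmodM z w : sqmod (z * w) = sqmod z * sqmod w.
Proof. by case: z w => [a b] [c d]; rewrite /sqmod /=; ring. Qed.

Lemma sqmod_conj z : sqmod (conjc z) = sqmod z.
Proof. by case: z => [a b]; rewrite /sqmod /= sqrrN. Qed.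

Lemma sqmodN z : sqmod (- z) = sqmod z.
Proof. by case: z => [a b]; rewrite /sqmod /= !sqrrN. Qed.

Lemma sqmod0 : sqmod (0 : R[i]) = 0.
Proof. by rewrite /sqmod /= expr0n addr0. Qed.

Lemma sqmod1 : sqmod (1 : R[i]) = 1.
Proof. by rewrite /sqmod /= expr0n expr1n addr0. Qed.

Lemma sqmodR (x : R) : sqmod x%:C = x ^+ 2.
Proof. by rewrite /sqmod /= expr0n addr0. Qed.

Lemma sqmod_eq0 z : (sqmod z == 0) = (z == 0).
Proof.
case: z => [a b]; rewrite /sqmod /= paddr_eq0 ?sqr_ge0// !sqrf_eq0.
by rewrite eq_complex.
Qed.

Lemma mulc_conj z : z * conjc z = (sqmod z)%:C.
Proof. by case: z => [a b]; apply/eqP; rewrite eq_complex /sqmod /=; apply/andP; split; apply/eqP; ring. Qed.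

Lemma conjcD z w : conjc (z + w) = conjc z + conjc w.
Proof. exact: rmorphD. Qed.
Lemma conjcM z w : conjc (z * w) = conjc z * conjc w.
Proof. exact: rmorphM. Qed.
Lemma conjcN z : conjc (- z) = - conjc z.
Proof. exact: rmorphN. Qed.

(** A modulus with values in [R]; the norm of [R[i]] takes its values in [R[i]]. *)
Definition cmod z : R := Num.sqrt (sqmod z).

Lemma cmod_sq z : cmod z ^+ 2 = sqmod z.
Proof. by rewrite sqr_sqrtr// sqmod_ge0. Qed.

Lemma cmod_ge0 z : 0 <= cmod z. Proof. exact: sqrtr_ge0. Qed.

Lemma cmodM z w : cmod (z * w) = cmod z * cmod w.
Proof. by rewrite /cmod sqmodM sqrtrM// sqmod_ge0. Qed.

Lemma cmod_conj z : cmod (conjc z) = cmod z.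
Proof. by rewrite /cmod sqmod_conj. Qed.

Lemma cmodN z : cmod (- z) = cmod z.
Proof. by rewrite /cmod sqmodN. Qed.

Lemma cmodR (x : R) : cmod x%:C = `|x|.
Proof. by rewrite /cmod sqmodR sqrtr_sqr. Qed.

Lemma cmod0 : cmod (0 : R[i]) = 0. Proof. by rewrite /cmod sqmod0 sqrtr0. Qed.
Lemma cmod1 : cmod (1 : R[i]) = 1. Proof. by rewrite /cmod sqmod1 sqrtr1. Qed.

Lemma Re_le_cmod z : `|Re z| <= cmod z.
Proof. by rewrite -sqrtr_sqr ler_wsqrtr// /sqmod lerDl sqr_ge0. Qed.

Lemma Im_le_cmod z : `|Im z| <= cmod z.
Proof. by rewrite -sqrtr_sqr ler_wsqrtr// /sqmod lerDr sqr_ge0. Qed.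

Lemma cmodD z w : cmod (z + w) <= cmod z + cmod w.
Proof.
have sq2 : sqmod (z + w) = sqmod z + sqmod w + 2 * Re (z * conjc w).
  by case: z w => [a b] [c d]; rewrite /sqmod /=; ring.
rewrite -(@ler_pXn2r _ 2)// ?nnegrE ?addr_ge0 ?cmod_ge0//.
rewrite sqrrD !cmod_sq sq2.
have := le_trans (ler_norm _) (Re_le_cmod (z * conjc w)).
by rewrite cmodM cmod_conj; lra.
Qed.

Lemma cmod_sum (T : Type) (s : seq T) (P : pred T) (f : T -> R[i]) :
  cmod (\sum_(k <- s | P k) f k) <= \sum_(k <- s | P k) cmod (f k).
Proof.
elim/big_ind2: _ => [|x1 x2 y1 y2 h1 h2|//]; first by rewrite cmod0.
by rewrite (le_trans (cmodD _ _))// lerD.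
Qed.

End Complex.

Section L2.
Context {R : realType} {I : choiceType}.
Implicit Types (u v w : l2 R I) (i j : I) (a : R[i]).

Lemma l2P u v : (forall i, u i = v i) -> u = v.
Proof. by move=> e; apply: val_inj; apply/funext. Qed.

Lemma l2DE u v i : (u + v) i = u i + v i. Proof. by []. Qed.
Lemma l2ZE a u i : (a *: u) i = a * u i. Proof. by []. Qed.
Lemma l2NE u i : (- u) i = - u i. Proof. by []. Qed.
Lemma l20E i : (0 : l2 R I) i = 0. Proof. by []. Qed.
Lemma l2sumE (T : Type) (s : seq T) (P : pred T) (f : T -> l2 R I) i :
  (\sum_(k <- s | P k) f k) i = \sum_(k <- s | P k) f k i.
Proof. by elim/big_rec2: _ => // k y1 y2 _ <-; rewrite l2DE. Qed.
Definition l2E := (l2DE, l2ZE, l2NE, l20E).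

Lemma l2_fin u : \esum_(i in [set: I]) (sqmod (u i))%:E \is a fin_num.
Proof.
case: u => f /= /asboolP h; rewrite ge0_fin_numE//.
by apply: esum_ge0 => i _; rewrite lee_fin sqmod_ge0.
Qed.

Lemma l2norm_ge0 u : 0 <= l2norm u. Proof. exact: sqrtr_ge0. Qed.

Lemma l2norm_sq u : l2norm u ^+ 2 = fine (\esum_(i in [set: I]) (sqmod (u i))%:E).
Proof.
by rewrite sqr_sqrtr// fine_ge0// esum_ge0// => i _; rewrite lee_fin sqmod_ge0.
Qed.

Lemma sum_le_l2norm u (s : seq I) : uniq s -> \sum_(i <- s) sqmod (u i) <= l2norm u ^+ 2.
Proof.
move=> us; rewrite l2norm_sq -lee_fin fineK ?l2_fin//.
by apply: sum_le_esum => // i; exact: sqmod_ge0.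
Qed.

Lemma l2norm_sq_le u M : (forall s, uniq s -> \sum_(i <- s) sqmod (u i) <= M) ->
  l2norm u ^+ 2 <= M.
Proof.
move=> h; rewrite l2norm_sq -lee_fin fineK ?l2_fin//.
by apply: esum_finP => // i; exact: sqmod_ge0.
Qed.

Lemma l2norm_approx u e : 0 < e -> exists2 s, uniq s &
  l2norm u ^+ 2 - e < \sum_(i <- s) sqmod (u i).
Proof.
move=> e0; apply: contrapT => h.
suff : l2norm u ^+ 2 <= l2norm u ^+ 2 - e by lra.
apply: l2norm_sq_le => s us; rewrite leNgt; apply/negP => hs.
by apply: h; exists s.
Qed.

(** A uniform bound on finite partial sums keeps [mkl2] away from its default value. *)
Lemma mkl2E (f : I -> R[i]) M :
  (forall s, uniq s -> \sum_(i <- s) sqmod (f i) <= M) -> forall i, mkl2 f i = f i.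
Proof.
move=> h i; rewrite /mkl2 insubdK//; apply/asboolP.
rewrite (le_lt_trans (@esum_finP _ _ _ M _ h)) ?ltry// => j; exact: sqmod_ge0.
Qed.

Lemma coord_le u i : sqmod (u i) <= l2norm u ^+ 2.
Proof. by have := @sum_le_l2norm u [:: i] isT; rewrite big_seq1. Qed.

Lemma cmod_coord_le u i : cmod (u i) <= l2norm u.
Proof. by rewrite -(@ler_pXn2r _ 2)// ?nnegrE ?cmod_ge0 ?l2norm_ge0// cmod_sq coord_le. Qed.

Lemma sum_delta (s : seq I) i (f : I -> R) : uniq s ->
  \sum_(j <- s) (if j == i then f j else 0) = if i \in s then f i else 0.
Proof.
move=> us; case: ifP => si.
  rewrite (bigD1_seq i)//= eqxx big1 ?addr0// => j /negPf ->//.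
rewrite big_seq big1// => j js; case: eqP => // ji; by rewrite -ji js in si.
Qed.

Lemma basisE i j : (basis i : l2 R I) j = (j == i)%:R.
Proof.
rewrite /basis (@mkl2E _ 1)// => s us.
rewrite (eq_bigr (fun k => if k == i then 1 else 0)) => [|k _].
  by rewrite sum_delta//; case: ifP.
by case: eqP; rewrite ?sqmod1 ?sqmod0.
Qed.

Lemma l2_csummable u v : csummable (fun i => u i * conjc (v i)).
Proof.
have h : \esum_(i in [set: I]) (sqmod (u i) + sqmod (v i))%:E \is a fin_num.
  by have [] := @esum_finD _ I (fun i => sqmod (u i)) (fun i => sqmod (v i))
     (fun=> sqmod_ge0 _) (fun=> sqmod_ge0 _) (l2_fin u) (l2_fin v).
have hb i : cmod (u i * conjc (v i)) <= sqmod (u i) + sqmod (v i).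
  rewrite cmodM cmod_conj -!cmod_sq.
  have := sqr_ge0 (cmod (u i) - cmod (v i)); have := cmod_ge0 (u i).
  have := cmod_ge0 (v i); nra.
by split; apply: esum_fin_le h => // i; apply: le_trans (hb i);
  rewrite ?Re_le_cmod ?Im_le_cmod.
Qed.

Lemma inner_lin a u v w : inner (a *: u + v) w = a * inner u w + inner v w.
Proof.
rewrite /inner -(csum_lin _ (l2_csummable _ _) (l2_csummable _ _)); congr csum.
by apply/funext => i; rewrite !l2E mulrDl mulrA.
Qed.

Lemma inner_conj u v : conjc (inner u v) = inner v u.
Proof.
rewrite /inner -csum_conj; congr csum; apply/funext => i.
by rewrite conjcM conjcK mulrC.
Qed.

Lemma inner_id u : inner u u = (l2norm u ^+ 2)%:C.
Proof.
rewrite /inner /csum; under [in X in X +i* _]eq_fun do rewrite mulc_conj.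
under [in X in _ +i* X]eq_fun do rewrite mulc_conj.
rewrite l2norm_sq rsum_ge0E//=; last by move=> i; exact: sqmod_ge0.
congr (_ +i* _); rewrite rsum_ge0E// esum1//.
Qed.

Lemma innerDl u v w : inner (u + v) w = inner u w + inner v w.
Proof. by rewrite -[u in LHS]scale1r inner_lin mul1r. Qed.
Lemma inner0l u : inner 0 u = 0.
Proof. by apply: (addrI (inner 0 u)); rewrite -innerDl !addr0. Qed.
Lemma innerZl a u w : inner (a *: u) w = a * inner u w.
Proof. by rewrite -[_ *: u]addr0 inner_lin inner0l addr0. Qed.
Lemma innerNl u w : inner (- u) w = - inner u w.
Proof. by rewrite -scaleN1r innerZl mulN1r. Qed.
Lemma innerBl u v w : inner (u - v) w = inner u w - inner v w.
Proof. by rewrite innerDl innerNl. Qed.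
Lemma innerDr u v w : inner w (u + v) = inner w u + inner w v.
Proof. by rewrite -inner_conj innerDl conjcD !inner_conj. Qed.
Lemma innerZr a u w : inner w (a *: u) = conjc a * inner w u.
Proof. by rewrite -inner_conj innerZl conjcM !inner_conj. Qed.
Lemma inner0r u : inner u 0 = 0.
Proof. by rewrite -inner_conj inner0l conjc0. Qed.
Lemma innerNr u w : inner w (- u) = - inner w u.
Proof. by rewrite -inner_conj innerNl conjcN !inner_conj. Qed.
Lemma innerBr u v w : inner w (u - v) = inner w u - inner w v.
Proof. by rewrite innerDr innerNr. Qed.
Lemma inner_suml (T : Type) (s : seq T) (P : pred T) (f : T -> l2 R I) w :
  inner (\sum_(k <- s | P k) f k) w = \sum_(k <- s | P k) inner (f k) w.
Proof.
by elim/big_rec2: _ => [|k y1 y2 _ <-]; rewrite ?inner0l// innerDl.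
Qed.

Lemma inner_basis u i : inner u (basis i) = u i.
Proof.
rewrite /inner (@csum_single _ _ _ i).
  by rewrite basisE eqxx conjc1 mulr1.
by move=> j /negPf ne; rewrite basisE ne conjc0 mulr0.
Qed.

Lemma l2normD_sq u v :
  l2norm (u + v) ^+ 2 = l2norm u ^+ 2 + l2norm v ^+ 2 + 2 * Re (inner u v).
Proof.
have /(congr1 (@complex.Re R)) := inner_id (u + v).
rewrite innerDl !innerDr !inner_id -(inner_conj u v) /=.
by case: (inner u v) => a b /=; lra.
Qed.

Lemma l2normZ_sq a u : l2norm (a *: u) ^+ 2 = sqmod a * l2norm u ^+ 2.
Proof.
have /(congr1 (@complex.Re R)) := inner_id (a *: u).
rewrite innerZl innerZr inner_id mulrA mulc_conj -rmorphM /= => <-//.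
Qed.

Lemma l2norm_pyth u v : inner u v = 0 ->
  l2norm (u + v) ^+ 2 = l2norm u ^+ 2 + l2norm v ^+ 2.
Proof. by move=> h; rewrite l2normD_sq h mulr0 addr0. Qed.

Lemma l2norm_eq0 u : l2norm u = 0 -> u = 0.
Proof.
move=> h; apply: l2P => i; rewrite l20E; apply/eqP; rewrite -sqmod_eq0.
by rewrite eq_le sqmod_ge0 andbT (le_trans (coord_le u i))// h expr0n.
Qed.

Lemma l2norm0 : l2norm (0 : l2 R I) = 0.
Proof.
apply/eqP; rewrite -sqrf_eq0; apply/eqP/(@complexI R).
by rewrite -inner_id inner0l.
Qed.

Lemma ler_sq (x y : R) : 0 <= y -> x ^+ 2 <= y ^+ 2 -> x <= y.
Proof.
move=> y0 h; rewrite leNgt; apply/negP => yx; move: h; rewrite leNgt.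
by rewrite ltr_pXn2r// ?nnegrE// ?yx// (le_trans y0)// ltW.
Qed.

Lemma cauchy_schwarz u v : cmod (inner u v) <= l2norm u * l2norm v.
Proof.
have [v0|vn0] := eqVneq (l2norm v) 0.
  by rewrite (l2norm_eq0 v0) inner0r cmod0 l2norm0 mulr0.
apply: ler_sq; first by rewrite mulr_ge0 ?l2norm_ge0.
(* This is |n u - c v|^2 >= 0, to be used with n = |v|^2 and c = <u, v>. *)
have key (n : R) (c : R[i]) :
    0 <= n ^+ 2 * l2norm u ^+ 2 + sqmod c * l2norm v ^+ 2
         - 2 * n * Re (conjc c * inner u v).
  have := sqr_ge0 (l2norm (n%:C *: u + (- c) *: v)).
  rewrite l2normD_sq (l2normZ_sq n%:C u).
  rewrite (l2normZ_sq (- c) v).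
  rewrite (sqmodR n) (sqmodN c).
  rewrite (innerZl n%:C).
  rewrite (innerZr (- c)).
  rewrite (conjcN c) mulNr.
  by case: (conjc c * inner u v) => a b /=; lra.
have := key (l2norm v ^+ 2) (inner u v).
have n0 : 0 < l2norm v ^+ 2 by rewrite exprn_gt0// lt_def vn0 l2norm_ge0.
rewrite [conjc _ * _]mulrC mulc_conj /= cmod_sq exprMn => h.
rewrite exprMn -(ler_pM2l n0); lra.
Qed.

Lemma l2normZ a u : l2norm (a *: u) = cmod a * l2norm u.
Proof.
apply/eqP; rewrite -(@eqrXn2 _ 2)// ?mulr_ge0 ?l2norm_ge0 ?cmod_ge0//.
by rewrite l2normZ_sq exprMn cmod_sq.
Qed.

Lemma l2normN u : l2norm (- u) = l2norm u.
Proof. by rewrite -scaleN1r l2normZ cmodN cmod1 mul1r. Qed.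

Lemma l2normD u v : l2norm (u + v) <= l2norm u + l2norm v.
Proof.
apply: ler_sq; first by rewrite addr_ge0 ?l2norm_ge0.
rewrite l2normD_sq; have h := cauchy_schwarz u v.
have := le_trans (Re_le_cmod _) h; rewrite ler_norml => /andP[_]; nra.
Qed.

Lemma l2normB u v : l2norm (u - v) <= l2norm u + l2norm v.
Proof. by rewrite (le_trans (l2normD _ _))// l2normN. Qed.

Lemma l2norm_sum (T : Type) (s : seq T) (P : pred T) (f : T -> l2 R I) :
  l2norm (\sum_(k <- s | P k) f k) <= \sum_(k <- s | P k) l2norm (f k).
Proof.
elim/big_ind2: _ => [|x1 x2 y1 y2 h1 h2|//]; first by rewrite l2norm0.
by rewrite (le_trans (l2normD _ _))// lerD.
Qed.

Lemma l2norm_basis i : l2norm (basis i : l2 R I) = 1.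
Proof.
apply/eqP; rewrite -(@eqrXn2 _ 2)// ?l2norm_ge0// expr1n.
have /(congr1 (@complex.Re R)) := inner_id (basis i).
by rewrite inner_basis basisE eqxx /= => <-.
Qed.

Definition trunc (s : seq I) u : l2 R I := \sum_(i <- s) u i *: basis i.

Lemma truncE s u i : uniq s -> trunc s u i = if i \in s then u i else 0.
Proof.
move=> us; rewrite /trunc l2sumE.
under eq_bigr do rewrite l2ZE basisE.
case: ifP => si.
  rewrite (bigD1_seq i)//= big1 => [|j ji]; first by rewrite eqxx mulr1 addr0.
  by rewrite eq_sym (negPf ji) mulr0.
rewrite big_seq big1// => j js; case: eqP => [e|]; last by rewrite mulr0.
by rewrite e js in si.
Qed.

Lemma trunc_tail u (e : R) : 0 < e -> exists2 s, uniq s &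
  forall s', uniq s' -> {subset s <= s'} -> l2norm (u - trunc s' u) <= e.
Proof.
move=> e0; have [|s us hs] := @l2norm_approx u (e ^+ 2); first by rewrite exprn_gt0.
exists s => // s' us' ss'; apply: ler_sq; first exact: ltW.
apply: l2norm_sq_le => t ut.
have -> : \sum_(i <- t) sqmod ((u - trunc s' u) i) = \sum_(i <- t | i \notin s') sqmod (u i).
  rewrite [RHS]big_mkcond; apply: eq_bigr => i _; rewrite !l2E truncE//.
  by case: (i \in s'); rewrite ?subrr ?subr0 ?sqmod0.
(* The part of [t] outside [s'] is disjoint from [s], so it only has the mass that [s] leaves
   over. *)
have := @sum_le_l2norm u (s ++ [seq i <- t | i \notin s']).
rewrite cat_uniq us filter_uniq// andbT big_cat /= big_filter.
have -> : ~~ has (in_mem^~ (mem s)) [seq i <- t | i \notin s'].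
  by apply/hasPn => i; rewrite mem_filter => /andP[+ _]; apply: contra => /ss'.
by move=> /(_ isT); lra.
Qed.

End L2.

(** * Orthogonal systems and p-th powers *)

Section PowR.
Context {R : realType}.
Implicit Types (p a b : R).

Lemma powR_mono p a b : 1 <= p -> 0 <= a -> a <= b -> a `^ p <= b `^ p.
Proof.
move=> p1 a0 ab; have p0 : 0 <= p by lra.
by apply: ge0_ler_powR => //; rewrite nnegrE// (le_trans a0).
Qed.

Lemma powR_addr p a b : 1 <= p -> 0 <= a -> 0 <= b ->
  (a + b) `^ p <= 2 `^ p * (a `^ p + b `^ p).
Proof.
move=> p1 a0 b0.
wlog ab : a b a0 b0 / a <= b.
  move=> h; have /orP[ab|ba] := le_total a b; first exact: h.
  by rewrite addrC [X in _ * X]addrC h.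
rewrite (@le_trans _ _ ((2 * b) `^ p))//.
  by apply: powR_mono => //; [rewrite addr_ge0 | lra].
by rewrite powRM// ler_wpM2l ?powR_ge0// lerDr powR_ge0.
Qed.

(** Young's inequality gives f_k S^(p-1) <= f_k^p / p + S^p (1 - 1/p). Summed with the weights,
    whose total is at most 1, it bounds S^p, and the last term is absorbed. The exponent p = 1 is
    separate since its conjugate is infinite. *)
Lemma jensen_powR (T : Type) (s : seq T) (w f : T -> R) p : 1 <= p ->
  (forall k, 0 <= w k) -> (forall k, 0 <= f k) -> \sum_(k <- s) w k <= 1 ->
  (\sum_(k <- s) w k * f k) `^ p <= \sum_(k <- s) w k * f k `^ p.
Proof.
move=> p1 w0 f0 w1; set S := \sum_(k <- s) w k * f k.
have S0 : 0 <= S by apply: sumr_ge0 => k _; rewrite mulr_ge0.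
have [pe|pn1] := eqVneq p 1.
  rewrite pe powRr1//; apply: ler_sum => k _; rewrite powRr1//.
have pgt1 : 1 < p by rewrite lt_def pn1.
have p0 : 0 < p by lra.
have q0 : 0 < (1 - p^-1)^-1.
  by rewrite invr_gt0 subr_gt0 invf_lt1.
have conj : p^-1 + (1 - p^-1)^-1^-1 = 1 by rewrite invrK; lra.
have Sq : (S `^ (p - 1)) `^ (1 - p^-1)^-1 = S `^ p.
  rewrite -powRrM; congr powR; have : p - 1 != 0 by rewrite subr_eq0.
  by move=> pm; field; rewrite pm gt_eqF.
have young k : f k * S `^ (p - 1) <= f k `^ p / p + S `^ p * (1 - p^-1).
  by rewrite -Sq -[X in _ + _ * X]invrK conjugate_powR// powR_ge0.
have SS : S * S `^ (p - 1) = S `^ p by rewrite mulr_powRB1.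
have key : S `^ p <= (\sum_(k <- s) w k * f k `^ p) / p + S `^ p * (1 - p^-1).
  rewrite -{1}SS {1}/S mulr_suml.
  apply: (@le_trans _ _ (\sum_(k <- s) (w k * f k `^ p / p + w k * (S `^ p * (1 - p^-1))))).
    by apply: ler_sum => k _; rewrite -2!mulrA -mulrDr ler_wpM2l.
  rewrite big_split /= -mulr_suml lerD2l -mulr_suml ler_piMl//.
  by rewrite mulr_ge0 ?powR_ge0// subr_ge0 invf_le1// ltW.
have : S `^ p * p^-1 <= (\sum_(k <- s) w k * f k `^ p) * p^-1 by lra.
by rewrite ler_pM2r// invr_gt0.
Qed.

(** Jensen's inequality uses the row sums; after exchanging the sums, the column sums remove the
    weights. *)
Lemma substochastic_powR (S T : Type) (s : seq S) (t : seq T)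
    (w : S -> T -> R) (f : T -> R) p : 1 <= p ->
  (forall n k, 0 <= w n k) -> (forall k, 0 <= f k) ->
  (forall n, \sum_(k <- t) w n k <= 1) -> (forall k, \sum_(n <- s) w n k <= 1) ->
  \sum_(n <- s) (\sum_(k <- t) w n k * f k) `^ p <= \sum_(k <- t) f k `^ p.
Proof.
move=> p1 w0 f0 wt ws.
apply: (@le_trans _ _ (\sum_(n <- s) \sum_(k <- t) w n k * f k `^ p)).
  by apply: ler_sum => n _; apply: jensen_powR.
rewrite exchange_big /=; apply: ler_sum => k _.
by rewrite -mulr_suml ler_piMl// powR_ge0.
Qed.

(* The factor [2 `^ p] spares an appeal to the continuity of powers. *)
Lemma sum_powR_perturb (T : eqType) (s : seq T) (f : T -> R) p C : 1 <= p ->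
  (forall k, 0 <= f k) ->
  (forall e, 0 < e -> exists g : T -> R, [/\ forall k, 0 <= g k,
     forall k, k \in s -> f k <= g k + e & \sum_(k <- s) g k `^ p <= C]) ->
  \sum_(k <- s) f k `^ p <= 2 `^ p * (C + 1).
Proof.
(* The error is taken as 1/n with n larger than the number of terms: since 1/n <= 1, its p-th power
   is at most 1/n, and the errors add up to at most 1. *)
move=> p1 f0 h; set n : R := (size s)%:R + 1.
have n1 : 1 <= n by rewrite lerDr.
have n0 : 0 < n by lra.
have [|g [g0 fg gC]] := h n^-1; first by rewrite invr_gt0.
apply: (@le_trans _ _ (\sum_(k <- s) 2 `^ p * (g k `^ p + n^-1))).
  rewrite big_seq [leRHS]big_seq; apply: ler_sum => k ks.
  rewrite (le_trans (powR_mono p1 (f0 k) (fg k ks)))//.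
  rewrite (le_trans (powR_addr p1 _ _))// ?invr_ge0 ?(ltW n0)//.
  rewrite ler_wpM2l ?powR_ge0// lerD2l ge1r_powR// invr_gt0 n0/=.
  by rewrite invf_le1.
rewrite -mulr_sumr ler_wpM2l ?powR_ge0// big_split /= lerD//.
rewrite big_const_seq count_predT iter_addr_0 -[_ *+ _]mulr_natl ler_pdivrMr//.
by rewrite mul1r lerDl.
Qed.

End PowR.

Section Orthogonal.
Context {R : realType} {I : choiceType}.
Implicit Types (u v w : l2 R I).

(* Zero members are allowed, so that [schatten]'s systems may be padded. *)
Definition orthosys (T : eqType) (e : T -> l2 R I) : Prop :=
  (forall m n, m != n -> inner (e m) (e n) = 0) /\ (forall n, l2norm (e n) <= 1).

Lemma orthosys_basis (T : eqType) (f : T -> I) : injective f ->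
  orthosys (fun i => basis (f i)).
Proof.
move=> fi; split=> [m n mn|n]; last by rewrite l2norm_basis.
by rewrite inner_basis basisE (inj_eq fi) eq_sym (negPf mn).
Qed.

Lemma orthosys_sum (T : eqType) (e : T -> l2 R I) (s : seq T) (c : T -> R[i]) :
  orthosys e -> uniq s ->
  l2norm (\sum_(n <- s) c n *: e n) ^+ 2 <= \sum_(n <- s) sqmod (c n).
Proof.
move=> [eo e1]; elim: s => [_|n s IH /= /andP[ns us]].
  by rewrite !big_nil l2norm0 expr0n.
rewrite !big_cons l2norm_pyth; last first.
  rewrite innerZl -inner_conj inner_suml big_seq big1 ?conjc0 ?mulr0// => k ks.
  rewrite innerZl eo ?mulr0//; apply: contraNneq ns => <-//.
rewrite lerD ?IH// l2normZ_sq ler_piMr ?sqmod_ge0//.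
by rewrite exprn_ile1// l2norm_ge0.
Qed.

(** Expand |u - v|^2 >= 0. Vectors of norm below 1 are allowed, so v need not be a projection of u,
    but |v|^2 <= B is all that is needed. *)
Lemma bessel (T : eqType) (e : T -> l2 R I) (s : seq T) u :
  orthosys e -> uniq s ->
  \sum_(n <- s) sqmod (inner u (e n)) <= l2norm u ^+ 2.
Proof.
move=> eo us; set v := \sum_(n <- s) inner u (e n) *: e n.
set B := \sum_(n <- s) _.
have uv : inner v u = B%:C.
  rewrite inner_suml rmorph_sum; apply: eq_bigr => n _.
  by rewrite innerZl -(inner_conj u) mulc_conj.
have v2 : l2norm v ^+ 2 <= B by exact: orthosys_sum.
have := sqr_ge0 (l2norm (- v + u)); rewrite l2normD_sq innerNl uv l2normN.
by rewrite raddfN /=; lra.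
Qed.

(** The source of the doubly substochastic weights: applied once to rows and once to columns of
    |<x_n, e_k>| |<y_n, f_k>|, it bounds both sums by 1. *)
Lemma orthosys_weight (T : eqType) (e f : T -> l2 R I) (s : seq T) u v :
  orthosys e -> orthosys f -> uniq s -> l2norm u <= 1 -> l2norm v <= 1 ->
  \sum_(n <- s) cmod (inner u (e n)) * cmod (inner v (f n)) <= 1.
Proof.
move=> eo fo us u1 v1.
have hu : l2norm u ^+ 2 <= 1 by rewrite exprn_ile1// l2norm_ge0.
have hv : l2norm v ^+ 2 <= 1 by rewrite exprn_ile1// l2norm_ge0.
apply: (@le_trans _ _ ((\sum_(n <- s) sqmod (inner u (e n)) +
    \sum_(n <- s) sqmod (inner v (f n))) / 2)).
  rewrite -big_split /= mulr_suml; apply: ler_sum => n _; rewrite -!cmod_sq.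
  have := sqr_ge0 (cmod (inner u (e n)) - cmod (inner v (f n))); lra.
have := bessel u eo us; have := bessel v fo us; lra.
Qed.

End Orthogonal.

(** * Singular value decomposition *)

Section Compact.
Context {R : realType} {I : choiceType}.
Implicit Types (X Y : op R I) (u v w e : l2 R I).

Lemma lin0 X : linear X -> X 0 = 0.
Proof. by move=> l; have := l (-1) 0 0; rewrite scaler0 addr0 scaleN1r addNr. Qed.
Lemma linD X u v : linear X -> X (u + v) = X u + X v.
Proof. by move=> l; have := l 1 u v; rewrite !scale1r. Qed.
Lemma linZ X a u : linear X -> X (a *: u) = a *: X u.
Proof. by move=> l; have := l a u 0; rewrite (lin0 l) !addr0. Qed.
Lemma linN X u : linear X -> X (- u) = - X u.
Proof. by move=> l; rewrite -scaleN1r (linZ _ _ l) scaleN1r. Qed.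
Lemma linB X u v : linear X -> X (u - v) = X u - X v.
Proof. by move=> l; rewrite (linD _ _ l) (linN _ l). Qed.
Lemma lin_sum X (T : Type) (s : seq T) (f : T -> l2 R I) : linear X ->
  X (\sum_(k <- s) f k) = \sum_(k <- s) X (f k).
Proof.
move=> l; elim: s => [|k s IH]; first by rewrite !big_nil (lin0 l).
by rewrite !big_cons (linD _ _ l) IH.
Qed.

(* Small off finitely many coordinates: for a linear map on l2 this is
   equivalent to compactness. *)
Definition cpt X := linear X /\ forall d : R, 0 < d -> exists F : seq I,
  forall u, (forall i, i \in F -> u i = 0) -> l2norm (X u) <= d * l2norm u.

Lemma trunc_off (F : seq I) u i : uniq F -> i \in F -> (u - trunc F u) i = 0.
Proof. by move=> uF iF; rewrite l2DE l2NE truncE// iF subrr. Qed.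

Lemma l2norm_mono u v : (forall i, sqmod (u i) <= sqmod (v i)) -> l2norm u <= l2norm v.
Proof.
move=> h; apply: ler_sq; first exact: l2norm_ge0.
apply: l2norm_sq_le => s us; apply: le_trans (sum_le_l2norm v us).
exact: ler_sum.
Qed.

Lemma l2norm_off (F : seq I) u : uniq F -> l2norm (u - trunc F u) <= l2norm u.
Proof.
move=> uF; apply: l2norm_mono => i; rewrite l2DE l2NE truncE//.
by case: ifP; rewrite ?subrr ?subr0// sqmod0 sqmod_ge0.
Qed.

Lemma lin_trunc_le X (F : seq I) u : linear X ->
  l2norm (X (trunc F u)) <= \sum_(i <- F) cmod (u i) * l2norm (X (basis i)).
Proof.
move=> l; rewrite /trunc lin_sum// (le_trans (l2norm_sum _ _ _))//.
by apply: ler_sum => i _; rewrite linZ// l2normZ.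
Qed.

Lemma cpt_uniq X (d : R) : cpt X -> 0 < d -> exists2 F : seq I, uniq F &
  forall u, l2norm (X u) <= l2norm (X (trunc F u)) + d * l2norm u.
Proof.
move=> [l c] d0; have [F h] := c d d0; exists (undup F); first exact: undup_uniq.
move=> u; have uF := undup_uniq F; set t := trunc _ _.
have -> : X u = X t + X (u - t) by rewrite -linD// addrC subrK.
rewrite (le_trans (l2normD _ _))// lerD2l (le_trans (h _ _))//.
  by move=> i iF; rewrite trunc_off// mem_undup.
by rewrite ler_wpM2l ?(ltW d0)// l2norm_off.
Qed.

Lemma cpt_bounded X : cpt X -> bounded_op X.
Proof.
move=> cX; have l := cX.1; split=> //.
have [F uF h] := cpt_uniq cX ltr01.
exists (\sum_(i <- F) l2norm (X (basis i)) + 1) => u.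
rewrite (le_trans (h u))// mulrDl lerD2r (le_trans (lin_trunc_le _ _ l))//.
rewrite mulr_suml; apply: ler_sum => i _; rewrite mulrC ler_wpM2l ?l2norm_ge0//.
exact: cmod_coord_le.
Qed.

(* Weak compactness of the unit ball, by an ultrafilter. *)
Lemma ball_ultra_limit (U : set_system nat) (u : nat -> l2 R I) :
  UltraFilter U -> (forall k, l2norm (u k) <= 1) ->
  exists2 g, l2norm g <= 1 & forall i, cmod (u k i - g i) @[k --> U] --> (0 : R).
Proof.
move=> UU u1.
have PU : ProperFilter U := @ultra_proper _ _ UU.
(* Compactness of [-1, 1] makes every bounded real sequence converge along the ultrafilter, without
   passing to subsequences. *)
have lim (a : nat -> R) : (forall k, `|a k| <= 1) -> exists l : R, a k @[k --> U] --> l.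
  move=> a1; have := @segment_compact R (-1) 1; rewrite compact_ultra.
  have AU : UltraFilter (a @ U).
    split; first exact: fmap_proper_filter.
    move=> G PG sG; rewrite eqEsubset; split=> // A GA; have [//|nA] := in_ultra_setVsetC (a @^-1` A) UU.
    have : G (A `&` ~` A) by apply: filterI => //; apply: sG.
    by rewrite setICr => /filter_ex[].
  move=> /(_ _ AU)[|l [_ al]]; last by exists l.
  by apply: (@filterE _ U) => k /=; rewrite in_itv/= -ler_norml.
have bd i k : cmod (u k i) <= 1 by rewrite (le_trans (cmod_coord_le _ _)).
have /choice[x hx] : forall i, exists l : R, Re (u k i) @[k --> U] --> l.
  by move=> i; apply: lim => k; rewrite (le_trans (Re_le_cmod _)).
have /choice[y hy] : forall i, exists l : R, Im (u k i) @[k --> U] --> l.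
  by move=> i; apply: lim => k; rewrite (le_trans (Im_le_cmod _)).
have cn (a : nat -> R) (l : R) : a k @[k --> U] --> l ->
    `|a k - l| @[k --> U] --> (0 : R).
  by move=> al; have := cvg_norm (cvgB al (cvg_cst l)); rewrite subrr normr0; exact.
pose g i := x i +i* y i.
have cv i : cmod (u k i - g i) @[k --> U] --> (0 : R).
  apply: (@squeeze_cvgr _ _ _ _ (fun=> 0) (fun k => `|Re (u k i) - x i| + `|Im (u k i) - y i|)).
  - apply: filterE => k; rewrite cmod_ge0/=.
    rewrite -[u k i - g i](_ : (Re (u k i) - x i)%:C + 'i%C * (Im (u k i) - y i)%:C = _).
      rewrite (le_trans (cmodD _ _))// cmodM !cmodR.
      by rewrite /cmod /sqmod /= expr0n add0r expr1n sqrtr1 mul1r.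
    rewrite /g; case: (u k i) => a b /=; apply/eqP; rewrite eq_complex /=.
    by apply/andP; split; apply/eqP; ring.
  - exact: cvg_cst.
  rewrite -[0 : R]addr0; apply: cvgD.
    exact: cn (hx i).
  exact: cn (hy i).
(* On finitely many coordinates, coordinatewise convergence is convergence in norm, so the
   truncation of the limit stays in the unit ball. *)
have g1 s : uniq s -> \sum_(i <- s) sqmod (g i) <= 1.
  move=> us; pose t (h : I -> R[i]) : l2 R I := \sum_(i <- s) h i *: basis i.
  have tE h i : i \in s -> t h i = h i.
    move=> si; rewrite /t l2sumE; under eq_bigr do rewrite l2ZE basisE.
    rewrite (bigD1_seq i)//= big1 => [|j ji]; first by rewrite eqxx mulr1 addr0.
    by rewrite eq_sym (negPf ji) mulr0.
  suff tg : l2norm (t g) <= 1.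
    apply: le_trans (exprn_ile1 2 (l2norm_ge0 _) tg).
    apply: le_trans (sum_le_l2norm (t g) us).
    by rewrite big_seq [leRHS]big_seq ler_sum// => i si; rewrite tE.
  apply/ler_addgt0Pr => d d0.
  have : (\sum_(i <- s) cmod (u k i - g i)) @[k --> U] --> (0 : R).
    rewrite [X in _ --> X](_ : _ = \sum_(i <- s) 0); last by rewrite big1.
    elim: s {us t tE} => [|i s IH].
      by under eq_fun do rewrite big_nil; rewrite big_nil; exact: cvg_cst.
    by under eq_fun do rewrite big_cons; rewrite big_cons; exact: cvgD.
  move=> /cvgrPdist_lt/(_ _ d0)/filter_ex[k].
  rewrite sub0r normrN ger0_norm ?sumr_ge0// => [hk|i _]; last exact: cmod_ge0.
  have -> : t g = trunc s (u k) - \sum_(i <- s) (u k i - g i) *: basis i.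
    rewrite /trunc -sumrB; apply: eq_bigr => i _.
    by rewrite -scalerBl opprB addrC subrK.
  rewrite (le_trans (l2normB _ _))// lerD//.
    rewrite (le_trans _ (u1 k))//; apply: l2norm_mono => i; rewrite truncE//.
    by case: ifP; rewrite ?sqmod0 ?sqmod_ge0.
  rewrite (le_trans _ (ltW hk))// (le_trans (l2norm_sum _ _ _))//.
  by apply: ler_sum => i _; rewrite l2normZ l2norm_basis mulr1.
exists (mkl2 g); last by move=> i; under eq_fun do rewrite (mkl2E g1); exact: cv.
apply: ler_sq => //; rewrite expr1n; apply: l2norm_sq_le => s us.
by under eq_bigr do rewrite (mkl2E g1); exact: g1.
Qed.

(** A weak limit of a maximizing sequence attains the supremum: off a finite set of coordinates X is
    uniformly small on the ball, and on that set the weak convergence is strong. *)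
Lemma cpt_max X : cpt X -> exists e, l2norm e <= 1 /\
  forall u, l2norm (X u) <= l2norm (X e) * l2norm u.
Proof.
move=> cX; have l := cX.1; have [_ [M hM]] := cpt_bounded cX.
pose A : set R := [set r | exists2 u, l2norm u <= 1 & r = l2norm (X u)].
have A0 : A !=set0 by exists (l2norm (X 0)); exists 0; rewrite ?l2norm0.
have Aub : has_ubound A.
  exists `|M| => _ [u u1 ->]; rewrite (le_trans (hM u))//.
  rewrite (@le_trans _ _ (`|M| * l2norm u))//.
    by rewrite ler_wpM2r ?l2norm_ge0// ler_norm.
  by rewrite ler_piMr.
have sA : has_sup A by [].
have /choice[u hu] : forall k : nat, exists u, l2norm u <= 1 /\
    sup A - k.+1%:R^-1 < l2norm (X u).
  move=> k; have [|_ [u u1 ->] h] := @sup_adherent _ A k.+1%:R^-1 _ sA.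
    by rewrite invr_gt0.
  by exists u.
have [U [UU sU]] := @ultraFilterLemma _ (nbhs \oo) _.
have PU : ProperFilter U := @ultra_proper _ _ UU.
have [g g1 hg] := ball_ultra_limit UU (fun k => (hu k).1).
have Sg : sup A <= l2norm (X g).
  (* Four errors of [d / 4]: the defect of the maximizing sequence, the tail of [u k], the
     difference of the two heads, and the tail of [g]. *)
  suff : forall d : R, 0 < d -> sup A <= l2norm (X g) + d by move/ler_addgt0Pr.
  move=> d d0; have d4 : 0 < d / 4 by rewrite divr_gt0.
  have [F uF hF] := cpt_uniq cX d4.
  have : (\sum_(i <- F) cmod (u k i - g i) * l2norm (X (basis i))) @[k --> U] --> (0 : R).
    rewrite [X in _ --> X](_ : _ = \sum_(i <- F) 0 * l2norm (X (basis i))); last first.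
      by rewrite big1// => i _; rewrite mul0r.
    elim: F {uF hF} => [|i F IH]; first by under eq_fun do rewrite big_nil; rewrite big_nil; exact: cvg_cst.
    under eq_fun do rewrite big_cons; rewrite big_cons; apply: cvgD => //.
    by apply: cvgM => //; exact: cvg_cst.
  move=> /cvgrPdist_lt/(_ _ d4) h1.
  have h2 : \forall k \near U, k.+1%:R^-1 < d / 4.
    apply: sU; have /cvgrPdist_lt/(_ _ d4) := @cvg_harmonic R.
    apply: filterS => k; rewrite sub0r normrN ger0_norm// /harmonic invr_ge0 ler0n//.
  have [k [/=]] := filter_ex (filterI h1 h2).
  rewrite sub0r normrN ger0_norm ?sumr_ge0// => [k1 k2|i _]; last by rewrite mulr_ge0 ?cmod_ge0 ?l2norm_ge0.
  have b1 := (hu k).2; have b2 := hF (u k).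
  have b3 : d / 4 * l2norm (u k) <= d / 4 by rewrite ler_piMr ?(hu k).1// ltW.
  have b4 : l2norm (X (trunc F (u k))) <= l2norm (X (trunc F g)) + d / 4.
    have -> : trunc F (u k) = trunc F g + trunc F (u k - g).
      rewrite /trunc -big_split /=; apply: eq_bigr => i _.
      have e : u k i = g i + (u k i - g i) by rewrite addrC subrK.
      by rewrite {1}e scalerDl.
    rewrite linD// (le_trans (l2normD _ _))// lerD2l.
    by rewrite (le_trans (lin_trunc_le _ _ l))// ltW.
  have b5 : l2norm (X (trunc F g)) <= l2norm (X g) + d / 4.
    have -> : trunc F g = g - (g - trunc F g) by rewrite opprB addrC subrK.
    rewrite linB// (le_trans (l2normB _ _))// lerD2l.
    have := hF (g - trunc F g).
    have -> : trunc F (g - trunc F g) = 0.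
      by rewrite /trunc big_seq big1// => i iF; rewrite trunc_off// scale0r.
    rewrite lin0// l2norm0 add0r => /le_trans; apply.
    by rewrite ler_piMr ?(ltW d4)// (le_trans (l2norm_off _ _)).
  have b0 : sup A < l2norm (X (u k)) + d / 4.
    by rewrite -ltrBlDr (lt_trans _ b1)// ltrD2l ltrN2.
  have b6 := le_trans b2 (lerD b4 b3).
  by lra.
exists g; split=> // v; have [v0|vn0] := eqVneq (l2norm v) 0.
  by rewrite (l2norm_eq0 v0) lin0// !l2norm0 mulr0.
have vp : 0 < l2norm v by rewrite lt_def vn0 l2norm_ge0.
rewrite -ler_pdivrMr// (le_trans _ Sg)//; apply: sup_upper_bound => //.
exists ((l2norm v)^-1%:C *: v).
  by rewrite l2normZ cmodR ger0_norm ?invr_ge0 ?(ltW vp)// mulVf.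
by rewrite linZ// l2normZ cmodR ger0_norm ?invr_ge0 ?(ltW vp)// mulrC.
Qed.

End Compact.

Section SVD.
Context {R : realType} {I : choiceType}.
Implicit Types (X Y : op R I) (u v w e : l2 R I).

Lemma l2norm_sub_proj u e : l2norm e <= 1 -> l2norm (u - inner u e *: e) <= l2norm u.
Proof.
move=> e1; apply: ler_sq; first exact: l2norm_ge0.
rewrite l2normD_sq l2normN l2normZ_sq innerNr innerZr [conjc _ * _]mulrC mulc_conj.
have e2 : l2norm e ^+ 2 <= 1 by rewrite exprn_ile1// l2norm_ge0.
rewrite raddfN /=; have := sqmod_ge0 (inner u e); nra.
Qed.

Lemma l2norm_sub_proj1 u e : l2norm e = 1 ->
  l2norm (u - inner u e *: e) ^+ 2 = l2norm u ^+ 2 - sqmod (inner u e).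
Proof.
move=> e1.
rewrite l2normD_sq l2normN l2normZ_sq innerNr innerZr [conjc _ * _]mulrC mulc_conj.
by rewrite raddfN /= e1; lra.
Qed.

Lemma inner_sub_proj u e : l2norm e = 1 -> inner (u - inner u e *: e) e = 0.
Proof. by move=> e1; rewrite innerBl innerZl inner_id e1 expr1n mulr1 subrr. Qed.

Section Maximal.
Variables (Y : op R I) (e : l2 R I).
Hypotheses (lY : linear Y) (e1 : l2norm e <= 1).
Hypothesis maxY : forall u, l2norm (Y u) <= l2norm (Y e) * l2norm u.
Hypothesis Ye0 : l2norm (Y e) != 0.

Let Ye : 0 < l2norm (Y e). Proof. by rewrite lt_def Ye0 l2norm_ge0. Qed.

Lemma maximal_norm : l2norm e = 1.
Proof.
apply/eqP; rewrite eq_le e1 /= -(ler_pM2l Ye) mulr1; exact: maxY.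
Qed.

(** Removing from e its component along v leaves Y e unchanged, while maximality forbids any
    shortening of e. *)
Lemma maximal_perp_ker v : l2norm v = 1 -> Y v = 0 -> inner e v = 0.
Proof.
move=> v1 Yv; have := maxY (e - inner e v *: v).
rewrite (linB _ _ lY) (linZ _ _ lY) Yv scaler0 subr0 -{1}[l2norm (Y e)]mulr1 ler_pM2l// => h.
have := exprn_ege1 2 h; rewrite l2norm_sub_proj1// maximal_norm expr1n => h2.
by apply/eqP; rewrite -sqmod_eq0 eq_le sqmod_ge0 andbT; lra.
Qed.

(** First variation at the maximum: perturbing e by c u changes |Y e|^2 to first order in c, but
    |e|^2 only to second order. The phase of c = t conj(b) turns the cross term into t |b|^2. *)
Lemma maximal_perp u : inner u e = 0 -> inner (Y u) (Y e) = 0.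
Proof.
move=> ue; set b := inner (Y u) (Y e).
have key (t : R) : 2 * t * sqmod b <=
    t ^+ 2 * sqmod b * (l2norm (Y e) ^+ 2 * l2norm u ^+ 2).
  set c := t%:C * conjc b.
  have h := maxY (e + c *: u).
  have {h} : l2norm (Y (e + c *: u)) ^+ 2 <= l2norm (Y e) ^+ 2 * l2norm (e + c *: u) ^+ 2.
    by rewrite -exprMn lerXn2r// nnegrE ?mulr_ge0 ?l2norm_ge0.
  rewrite (linD _ _ lY) (linZ _ _ lY).
  have -> : l2norm (e + c *: u) ^+ 2 = 1 + sqmod c * l2norm u ^+ 2.
    have eu : inner e (c *: u) = 0 by rewrite innerZr -(inner_conj u) ue conjc0 mulr0.
    by rewrite (l2norm_pyth eu) (l2normZ_sq c) maximal_norm expr1n.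
  rewrite (l2normD_sq (Y e)) (l2normZ_sq c (Y u)) (innerZr c) -(inner_conj (Y u)) -/b.
  have -> : Re (conjc c * conjc b) = t * sqmod b.
    rewrite /c conjcM conjcK conjc_real -mulrA mulc_conj.
    by rewrite -rmorphM.
  rewrite /c sqmodM sqmodR sqmod_conj.
  have := mulr_ge0 (mulr_ge0 (sqr_ge0 t) (sqmod_ge0 b)) (sqr_ge0 (l2norm (Y u))).
  by lra.
apply/eqP; rewrite -sqmod_eq0; apply: contraT => bn0.
have bp : 0 < sqmod b by rewrite lt_def bn0 sqmod_ge0.
set K := l2norm (Y e) ^+ 2 * l2norm u ^+ 2.
have K0 : 0 <= K by rewrite mulr_ge0 ?sqr_ge0.
have K1 : 0 < K + 1 by lra.
(* For t = 1 / (K + 1) the inequality would read 2 (K + 1) <= K. *)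
have := key (K + 1)^-1; rewrite -/K.
have -> : 2 / (K + 1) * sqmod b = (2 * (K + 1)) * (sqmod b / (K + 1) ^+ 2).
  by field; rewrite gt_eqF.
have -> : (K + 1)^-1 ^+ 2 * sqmod b * K = K * (sqmod b / (K + 1) ^+ 2).
  by field; rewrite gt_eqF.
rewrite ler_pM2r; first by lra.
by rewrite divr_gt0// exprn_gt0.
Qed.

End Maximal.

Definition maxvec X : l2 R I := xget 0 [set e | l2norm e <= 1 /\
  forall u, l2norm (X u) <= l2norm (X e) * l2norm u].

(** Deflation acts on the argument; by linearity this subtracts the rank one operator <., e_n> A_n
    e_n, so the adjoint of X is avoided. *)
Fixpoint deflate X n : op R I :=
  if n is m.+1 then fun u => deflate X m (u - inner u (maxvec (deflate X m)) *: maxvec (deflate X m))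
  else X.

(** Besides the set for X, take a finite set G carrying almost all of e: if u vanishes on G, then
    <u, e> only sees the small tail of e. *)
Lemma cpt_deflate1 X e : cpt X -> cpt (fun u => X (u - inner u e *: e)).
Proof.
move=> [l c]; split=> [a u v|d d0].
  rewrite inner_lin -l; congr X; apply: l2P => i; rewrite !l2E; ring.
have d2 : 0 < d / 2 by rewrite divr_gt0.
have [F hF] := c _ d2.
have k0 : 0 < l2norm (X e) + 1 by rewrite ltr_wpDl// l2norm_ge0.
have [G uG hG] := @trunc_tail R I e (d / 2 / (l2norm (X e) + 1)) (divr_gt0 d2 k0).
exists (F ++ G) => u hu.
have hc : cmod (inner u e) <= l2norm u * (d / 2 / (l2norm (X e) + 1)).
  have -> : inner u e = inner u (e - trunc G e).
    rewrite innerBr -[inner u (trunc _ _)]inner_conj inner_suml big_seq big1 ?conjc0 ?subr0// => i iG.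
    by rewrite innerZl -inner_conj inner_basis hu ?mem_cat ?iG ?orbT// conjc0 mulr0.
  rewrite (le_trans (cauchy_schwarz _ _))// ler_wpM2l ?l2norm_ge0//.
  exact: hG.
rewrite (linB _ _ l) (linZ _ _ l) (le_trans (l2normB _ _))// l2normZ.
have h1 : l2norm (X u) <= d / 2 * l2norm u by apply: hF => i iF; apply: hu; rewrite mem_cat iF.
have h2 : cmod (inner u e) * l2norm (X e) <= l2norm u * (d / 2).
  apply: (@le_trans _ _ (l2norm u * (d / 2 / (l2norm (X e) + 1)) * l2norm (X e))).
    by rewrite ler_wpM2r ?l2norm_ge0.
  rewrite -[leLHS]mulrA ler_wpM2l ?l2norm_ge0// -[leRHS]mulr1 -[leLHS]mulrA.
  by rewrite ler_wpM2l ?(ltW d2)// mulrC ler_pdivrMr// mul1r lerDl.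
lra.
Qed.

Section Singular.
Variable X : op R I.
Hypothesis cX : cpt X.
Local Notation A := (deflate X).
Let e n := maxvec (A n).
Let s n := l2norm (A n (e n)).

Lemma cpt_deflate n : cpt (A n).
Proof. by elim: n => [//|n IH]; exact: cpt_deflate1. Qed.

Let lA n : linear (A n) := (cpt_deflate n).1.

Let maxP n : l2norm (e n) <= 1 /\ forall u, l2norm (A n u) <= s n * l2norm u.
Proof.
rewrite /s /e /maxvec; case: xgetP => [? _ //|h].
by have [x hx] := cpt_max (cpt_deflate n); case: (h x).
Qed.

Let s_ge0 n : 0 <= s n. Proof. exact: l2norm_ge0. Qed.

Let s0 n : s n = 0 -> A n (e n) = 0. Proof. exact: l2norm_eq0. Qed.

Let e_norm n : s n != 0 -> l2norm (e n) = 1.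
Proof. by move=> sn; exact: (maximal_norm (maxP n).1 (maxP n).2 sn). Qed.

Let AS n u : A n.+1 u = A n (u - inner u (e n) *: e n). Proof. by []. Qed.

Let AE n u : A n u = X u - \sum_(k < n) inner u (e k) *: A k (e k).
Proof.
elim: n => [|n IH]; first by rewrite big_ord0 subr0.
by rewrite AS (linB _ _ (@lA n)) (linZ _ _ (@lA n)) IH big_ord_recr /= opprD addrA.
Qed.

(** The vector e_k is killed at stage k + 1 and remains in the kernel, because each later maximizer
    with s_n nonzero is orthogonal to it. *)
Let A_ker n k : (k < n)%N -> s k != 0 -> A n (e k) = 0.
Proof.
elim: n => [//|n IH]; rewrite ltnS leq_eqVlt => /orP[/eqP ->|kn] sk.
  by rewrite AS inner_id (e_norm sk) expr1n scale1r subrr (lin0 (@lA n)).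
rewrite AS (linB _ _ (@lA n)) (linZ _ _ (@lA n)) IH// sub0r.
have [sn|sn] := eqVneq (s n) 0; first by rewrite (s0 sn) scaler0 oppr0.
have h := maximal_perp_ker (@lA n) (maxP n).1 (maxP n).2 sn (e_norm sk) (IH kn sk).
by rewrite -inner_conj h conjc0 scale0r oppr0.
Qed.

Let e_perp n k : (k < n)%N -> s k != 0 -> s n != 0 -> inner (e n) (e k) = 0.
Proof.
move=> kn sk sn.
exact: (maximal_perp_ker (@lA n) (maxP n).1 (maxP n).2 sn (e_norm sk) (A_ker kn sk)).
Qed.

Let A_perp n k u : (k < n)%N -> inner (A n u) (A k (e k)) = 0.
Proof.
have [sk|sk] := eqVneq (s k) 0; first by rewrite (s0 sk) inner0r.
elim: n u => [//|n IH] u; rewrite ltnS leq_eqVlt => /orP[/eqP ke|kn]; last by rewrite AS IH.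
rewrite AS -ke; apply: (maximal_perp (@lA k) (maxP k).1 (maxP k).2 sk).
by rewrite inner_sub_proj// e_norm.
Qed.

Let XE n : s n != 0 -> X (e n) = A n (e n).
Proof.
move=> sn; rewrite AE big1 ?subr0// => k _.
have [sk|sk] := eqVneq (s k) 0; first by rewrite (s0 sk) scaler0.
by rewrite (e_perp (ltn_ord k) sk sn) scale0r.
Qed.

Let s_dec n : s n.+1 <= s n.
Proof.
rewrite {1}/s AS (le_trans ((maxP n).2 _))// ler_piMr//.
by rewrite (le_trans (l2norm_sub_proj _ (maxP n).1))// (maxP n.+1).1.
Qed.

(** If s_n stayed above d, every e_n would carry mass more than r on one finite set F. By Bessel's
    inequality at each basis vector of F, orthogonal vectors have total mass at most |F| there, a
    contradiction for many n. *)
Let s_cvg : s @ \oo --> (0 : R).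
Proof.
have sdec m n : (m <= n)%N -> s n <= s m.
  by move=> /subnK <-; elim: (n - m)%N => [//|k IH]; rewrite addSn (le_trans (s_dec _)).
suff h (d : R) : 0 < d -> exists n, s n <= d.
  apply/cvgrPdist_le => d /h[n nd]; exists n => // m /= nm.
  by rewrite sub0r normrN ger0_norm// (le_trans (sdec _ _ nm)).
move=> d0; apply: contrapT => hn.
have sd n : d < s n by rewrite ltNge; apply/negP => h; apply: hn; exists n.
have sn0 n : s n != 0 by rewrite gt_eqF// (lt_trans d0).
have eo : orthosys e.
  split=> [m n mn|n]; last exact: (maxP n).1.
  have [l|l|el] := ltngtP m n; last by rewrite el eqxx in mn.
    by rewrite -inner_conj e_perp// conjc0.
  by rewrite e_perp.
have d2 : 0 < d / 2 by rewrite divr_gt0.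
have [F uF hF] := cpt_uniq cX d2.
pose K := \sum_(i <- F) l2norm (X (basis i)) + 1.
have K0 : 0 < K by rewrite ltr_wpDl// sumr_ge0// => i _; exact: l2norm_ge0.
(* With mass at most r on F, all coordinates there are at most d / (2 K); then head and tail of X
   e_n are each at most d / 2. *)
pose r := (d / 2 / K) ^+ 2.
have r0 : 0 < r by rewrite exprn_gt0// divr_gt0.
have big n : r < \sum_(i <- F) sqmod (e n i).
  rewrite ltNge; apply/negP => h.
  have ci i : i \in F -> cmod (e n i) <= d / 2 / K.
    move=> iF; apply: ler_sq; first by rewrite divr_ge0// ltW.
    rewrite cmod_sq (le_trans _ h)// (bigD1_seq i)//= lerDl sumr_ge0// => j _.
    exact: sqmod_ge0.
  have := sd n; rewrite ltNge => /negP; apply.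
  rewrite /s -XE// (le_trans (hF _))//.
  have l1 : d / 2 * l2norm (e n) <= d / 2 by rewrite ler_piMr ?(ltW d2) ?(maxP n).1.
  have l2 : l2norm (X (trunc F (e n))) <= d / 2.
    rewrite (le_trans (lin_trunc_le _ _ cX.1))//.
    apply: (@le_trans _ _ (\sum_(i <- F) d / 2 / K * l2norm (X (basis i)))).
      by rewrite big_seq [leRHS]big_seq ler_sum// => i iF; rewrite ler_wpM2r ?l2norm_ge0 ?ci.
    rewrite -mulr_sumr -mulrA ler_piMr ?(ltW d2)// mulrC ler_pdivrMr// mul1r.
    by rewrite /K lerDl.
  by lra.
have [N hN] : exists N : nat, (size F)%:R / r < N%:R.
  exists (Num.truncn ((size F)%:R / r)).+1; exact: truncnS_gt.
have := hN; rewrite ltr_pdivrMr// ltNge => /negP; apply.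
apply: (@le_trans _ _ (\sum_(n <- iota 0 N) \sum_(i <- F) sqmod (e n i))).
  have -> : N%:R * r = \sum_(n <- iota 0 N) r.
    by rewrite big_const_seq count_predT size_iota iter_addr_0 mulr_natl.
  by apply: ler_sum => n _; exact: ltW.
rewrite exchange_big /= -[leRHS]mul1r -sum1_size natr_sum mul1r.
apply: ler_sum => i _.
have := bessel (basis i) eo (iota_uniq 0 N); rewrite l2norm_basis expr1n => /(le_trans _); apply.
by apply: ler_sum => n _; rewrite -inner_conj sqmod_conj inner_basis.
Qed.

(** The remainder after N terms is the deflated operator A_N, of norm at most s_N. The last clause,
    X e_n = s_n f_n, is what allows the singular values to be read off as matrix coefficients. *)
Lemma compact_svd : exists (s : nat -> R) (e f : nat -> l2 R I),
  [/\ forall n, 0 <= s n, orthonormal_on [set n | s n != 0] e,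
   orthonormal_on [set n | s n != 0] f,
   forall u, l2norm (X u - \sum_(0 <= n < N) ((s n)%:C * inner u (e n)) *: f n)
      @[N --> \oo] --> (0 : R) & s @ \oo --> (0 : R) /\
   forall n, s n != 0 -> X (e n) = (s n)%:C *: f n].
Proof.
pose f n := (s n)^-1%:C *: A n (e n).
have fE n : s n != 0 -> (s n)%:C *: f n = A n (e n).
  by move=> sn; rewrite scalerA -rmorphM /= mulfV// scale1r.
exists s, e, f; split=> //.
- move=> m n /= sm sn; have [l|l|->] := ltngtP m n.
  + by rewrite -inner_conj e_perp// conjc0.
  + by rewrite e_perp.
  by rewrite inner_id e_norm// expr1n.
- move=> m n /= sm sn; rewrite /f innerZl innerZr; have [l|l|->] := ltngtP m n.
  + by rewrite -inner_conj A_perp// conjc0 !mulr0.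
  + by rewrite A_perp// !mulr0.
  rewrite inner_id conjc_real -!rmorphM -/(s n).
  by have -> : (s n)^-1 * ((s n)^-1 * s n ^+ 2) = 1 by field.
- move=> u; have AN N : X u - \sum_(0 <= n < N) ((s n)%:C * inner u (e n)) *: f n = A N u.
    rewrite AE big_mkord; congr (_ - _); apply: eq_bigr => k _.
    have [sk|sk] := eqVneq (s k) 0; first by rewrite sk mul0r scale0r (s0 sk) scaler0.
    by rewrite mulrC -scalerA fE.
  under eq_fun do rewrite AN.
  apply: (@squeeze_cvgr _ _ _ _ (fun=> 0) (fun N => s N * l2norm u)).
  + by apply: nearW => N; rewrite l2norm_ge0 (maxP N).2.
  + exact: cvg_cst.
  by rewrite -(mul0r (l2norm u)); apply: cvgM => //; exact: cvg_cst.
by split=> // n sn; rewrite fE// XE.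
Qed.

End Singular.

End SVD.

(** * Schatten classes *)

Section Schatten.
Context {R : realType} {I : choiceType}.
Implicit Types (X Y : op R I) (u v w : l2 R I).

Lemma cmod_innerC u v : cmod (inner u v) = cmod (inner v u).
Proof. by rewrite -inner_conj cmod_conj. Qed.

(* Unlike a singular value decomposition, this form of membership in S_p is
   visibly stable under sums. *)
Definition psum (p : R) X := exists C : R,
  forall (T : eqType) (x y : T -> l2 R I), orthosys x -> orthosys y ->
  forall s, uniq s -> \sum_(n <- s) cmod (inner (X (x n)) (y n)) `^ p <= C.

Lemma orthonormal_on_mask (s : nat -> R) (e : nat -> l2 R I) :
  orthonormal_on [set n | s n != 0] e ->
  orthosys (fun n => if s n == 0 then 0 else e n).
Proof.
move=> eo; split=> [m n mn|n].
  case: ifPn => sm; rewrite ?inner0l//; case: ifPn => sn; rewrite ?inner0r//.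
  by rewrite eo// (negPf mn).
case: ifPn => sn; rewrite ?l2norm0//.
have := eo n n sn sn; rewrite inner_id eqxx => -[h].
by apply: ler_sq => //; rewrite h expr1n.
Qed.

(** Where s_n = 0 nothing is known about e_n and f_n; replacing them by 0 leaves the series
    unchanged and makes both systems orthogonal everywhere. *)
Lemma schatten_masked p X : schatten p X -> exists (s : nat -> R) (e f : nat -> l2 R I),
  [/\ forall n, 0 <= s n, orthosys e, orthosys f,
    forall u, l2norm (X u - \sum_(0 <= n < N) ((s n)%:C * inner u (e n)) *: f n)
        @[N --> \oo] --> (0 : R) &
    match p with
    | p'%:E => (\sum_(0 <= n <oo) (s n `^ p')%:E < +oo)%E
    | +oo%E => s @ \oo --> (0 : R)
    | -oo%E => False
    end].
Proof.
move=> [_ [s [e [f [s0 eo fo cv h]]]]].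
exists s, (fun n => if s n == 0 then 0 else e n), (fun n => if s n == 0 then 0 else f n).
split=> //; [exact: orthonormal_on_mask|exact: orthonormal_on_mask|move=> u].
under eq_fun => N.
  under eq_bigr => n _.
    rewrite (_ : _ *: _ = ((s n)%:C * inner u (e n)) *: f n); last first.
      by case: ifPn => // /eqP ->; rewrite !mul0r !scale0r.
    over.
  over.
exact: cv.
Qed.

Lemma nneseries_bound (a : nat -> R) N : (forall n, 0 <= a n) ->
  (\sum_(0 <= n <oo) (a n)%:E < +oo)%E ->
  \sum_(0 <= n < N) a n <= fine (\sum_(0 <= n <oo) (a n)%:E)%E.
Proof.
move=> a0 h; rewrite -lee_fin fineK; last first.
  by rewrite ge0_fin_numE//; apply: nneseries_ge0 => n _ _; rewrite lee_fin.
rewrite -sumEFin; apply: nneseries_lim_ge => n _ _; by rewrite lee_fin.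
Qed.

Lemma near_seq (T : eqType) (s : seq T) (P : T -> nat -> Prop) :
  (forall t, t \in s -> \forall N \near \oo, P t N) ->
  \forall N \near \oo, forall t, t \in s -> P t N.
Proof.
elim: s => [|t s IH] h; first by apply: nearW.
have h1 := h t (mem_head _ _).
have h2 := IH (fun t' t's => h t' (mem_behead (s := t :: s) t's)).
apply: filterS2 h1 h2 => N p1 p2 t'; rewrite in_cons => /orP[/eqP ->//|]; exact: p2.
Qed.

(** Expanding X gives |<X x_n, y_n>| <= sum_k w_nk s_k with doubly substochastic w. Since only
    finitely many n matter at a time, the series may be cut at a common N. *)
Lemma schatten_psum p X : 1 <= p -> schatten p%:E X -> psum p X.
Proof.
move=> p1 /schatten_masked[s [e [f [s0 eo fo cv sp]]]].
have sp0 n : 0 <= s n `^ p by exact: powR_ge0.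
set M := fine (\sum_(0 <= n <oo) (s n `^ p)%:E)%E.
have hM N : \sum_(0 <= n < N) s n `^ p <= M by exact: nneseries_bound.
exists (2 `^ p * (M + 1)) => T x y xo yo t ut.
apply: sum_powR_perturb => // [n|d d0]; first exact: cmod_ge0.
pose XN N u := \sum_(0 <= n < N) ((s n)%:C * inner u (e n)) *: f n.
have [N hN] : exists N, forall n, n \in t -> l2norm (X (x n) - XN N (x n)) <= d.
  apply: (@filter_ex _ \oo); apply: near_seq => n _.
  have /cvgrPdist_le/(_ _ d0) := cv (x n); apply: filterS => N.
  by rewrite sub0r normrN ger0_norm ?l2norm_ge0.
exists (fun n => cmod (inner (XN N (x n)) (y n))); split=> [n|n nt|].
- exact: cmod_ge0.
- have -> : X (x n) = XN N (x n) + (X (x n) - XN N (x n)) by rewrite addrC subrK.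
  rewrite innerDl (le_trans (cmodD _ _))// lerD2l (le_trans (cauchy_schwarz _ _))//.
  rewrite -[leRHS]mulr1.
  exact: ler_pM (l2norm_ge0 _) (l2norm_ge0 _) (hN n nt) (yo.2 n).
apply: le_trans (hM N).
pose w n k := cmod (inner (x n) (e k)) * cmod (inner (y n) (f k)).
apply: (@le_trans _ _ (\sum_(n <- t) (\sum_(k <- index_iota 0 N) w n k * s k) `^ p)).
  apply: ler_sum => n _; apply: powR_mono => //; first exact: cmod_ge0.
  rewrite /XN inner_suml (le_trans (cmod_sum _ _ _))//; apply: ler_sum => k _.
  rewrite innerZl !cmodM cmodR ger0_norm// (cmod_innerC (f k)) /w.
  by rewrite mulrAC mulrC mulrA mulrAC.
apply: substochastic_powR => // [n k|n|k].
- by rewrite mulr_ge0 ?cmod_ge0.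
- by apply: orthosys_weight => //; [exact: iota_uniq|exact: xo.2|exact: yo.2].
under eq_bigr => n _ do rewrite /w (cmod_innerC (x n)) (cmod_innerC (y n)).
by apply: orthosys_weight => //; [exact: eo.2|exact: fo.2].
Qed.

Lemma schatten_cvg p (s : nat -> R) : (1%:E <= p)%E -> (forall n, 0 <= s n) ->
  match p return Prop with
  | p'%:E => (\sum_(0 <= n <oo) (s n `^ p')%:E < +oo)%E
  | +oo%E => s @ \oo --> (0 : R)
  | -oo%E => False
  end -> s @ \oo --> (0 : R).
Proof.
case: p => [p||]// p1 s0 h; rewrite lee_fin in p1.
have sp0 n : 0 <= s n `^ p by exact: powR_ge0.
set M := fine (\sum_(0 <= n <oo) (s n `^ p)%:E)%E.
have : cvgn (series (fun n => s n `^ p)).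
  apply: nondecreasing_is_cvgn.
    by apply/nondecreasing_seqP => n; rewrite /series /= big_nat_recr//= lerDl.
  by exists M => _ [N _ <-]; rewrite /series /=; exact: nneseries_bound.
move=> /cvg_series_cvg_0 c; apply/cvgrPdist_le => d d0.
have dp : 0 < d `^ p by exact: powR_gt0.
move/cvgrPdist_lt : c => /(_ _ dp); apply: filterS => n.
rewrite !sub0r !normrN !ger0_norm// => h1; rewrite leNgt; apply/negP => h2.
by move: h1; rewrite ltNge => /negP; apply; apply: powR_mono => //; exact: ltW.
Qed.

(** Basis vectors tend weakly to 0. Each of the first K singular vectors has small coordinates off a
    finite set; the later terms have s_n <= d / 3 and are summed by Bessel's inequality. The third
    [d / 3] is the remainder of the series. *)
Lemma schatten_null p X : (1%:E <= p)%E -> schatten p X ->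
  forall d : R, 0 < d -> exists F : seq I,
  forall i, i \notin F -> l2norm (X (basis i)) <= d.
Proof.
move=> p1 /schatten_masked[s [e [f [s0 eo fo cv /(schatten_cvg p1 s0) sc]]]] d d0.
have d3 : 0 < d / 3 by rewrite divr_gt0.
have [K _ hK] : \forall n \near \oo, s n <= d / 3.
  have /cvgrPdist_le/(_ _ d3) := sc; apply: filterS => n.
  by rewrite sub0r normrN ger0_norm.
pose S := \sum_(0 <= n < K) s n + 1.
have S0 : 0 < S by rewrite ltr_wpDl// sumr_ge0.
have dS : 0 < d / 3 / S by rewrite divr_gt0.
have /choice[F hF] : forall k, exists F : seq I, forall i, i \notin F -> cmod (e k i) <= d / 3 / S.
  move=> k; have [F uF hF] := trunc_tail (e k) dS; exists F => i iF.
  apply: le_trans (hF F uF (fun _ => id)).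
  have := cmod_coord_le (e k - trunc F (e k)) i.
  by rewrite l2DE l2NE truncE// (negPf iF) subr0.
exists (flatten [seq F k | k <- iota 0 K]) => i iF.
have ek k : (k < K)%N -> cmod (inner (basis i) (e k)) <= d / 3 / S.
  move=> kK; rewrite cmod_innerC inner_basis; apply: hF; apply: contra iF => iF.
  by apply/flatten_mapP; exists k => //; rewrite mem_iota.
have [N [KN hN]] : exists N, (K <= N)%N /\
   l2norm (X (basis i) - \sum_(0 <= n < N) ((s n)%:C * inner (basis i) (e n)) *: f n) <= d / 3.
  apply: (@filter_ex _ \oo); apply: filterI; first exact: nbhs_infty_ge.
  have /cvgrPdist_le/(_ _ d3) := cv (basis i); apply: filterS => N.
  by rewrite sub0r normrN ger0_norm ?l2norm_ge0.
move: hN; rewrite (big_cat_nat (leq0n K) KN)//=; set a := \sum_(0 <= n < K) _; set b := \sum_(K <= n < N) _.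
move=> hN.
have ha : l2norm a <= d / 3.
  rewrite (le_trans (l2norm_sum _ _ _))//.
  apply: (@le_trans _ _ (\sum_(0 <= n < K) s n * (d / 3 / S))).
    rewrite big_nat [leRHS]big_nat; apply: ler_sum => k /andP[_ kK].
    rewrite l2normZ cmodM cmodR ger0_norm// -mulrA ler_wpM2l//.
    rewrite -[leRHS]mulr1.
    exact: ler_pM (cmod_ge0 _) (l2norm_ge0 _) (ek k kK) (fo.2 k).
  rewrite -mulr_suml mulrC -[leLHS]mulrA ler_piMr ?(ltW d3)// mulrC ler_pdivrMr// mul1r.
  by rewrite /S lerDl.
have hb : l2norm b <= d / 3.
  apply: ler_sq; first exact: ltW.
  rewrite (le_trans (orthosys_sum _ fo (iota_uniq _ _)))//.
  apply: (@le_trans _ _ (\sum_(K <= n < N) (d / 3) ^+ 2 * sqmod (inner (basis i) (e n)))).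
    rewrite big_nat [leRHS]big_nat; apply: ler_sum => k /andP[kK _].
    rewrite sqmodM sqmodR ler_wpM2r ?sqmod_ge0// lerXn2r ?nnegrE ?hK//.
    exact: ltW.
  rewrite -mulr_sumr ler_piMr ?sqr_ge0//.
  by have := bessel (basis i) eo (iota_uniq K (N - K)); rewrite l2norm_basis expr1n.
have -> : X (basis i) = (X (basis i) - (a + b)) + (a + b) by rewrite subrK.
have h1 := l2normD (X (basis i) - (a + b)) (a + b).
have h2 := l2normD a b; lra.
Qed.

(** Testing [psum] on the singular systems of X gives <X e_n, f_n> = s_n, hence summability of
    s_n^p; for p = oo the decomposition suffices. *)
Lemma cpt_schatten p X : (1%:E <= p)%E -> cpt X ->
  (forall r, p = r%:E -> psum r X) -> schatten p X.
Proof.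
move=> p1 cX ps; split; first exact: cpt_bounded.
have [s [e [f [s0 eo fo cv [sc Xe]]]]] := compact_svd cX.
exists s, e, f; split=> //; case: p p1 ps => [p||]// p1 ps; rewrite lee_fin in p1.
have [C hC] := ps p erefl.
have sC N : \sum_(0 <= n < N) s n `^ p <= C.
  have := hC _ _ _ (orthonormal_on_mask eo) (orthonormal_on_mask fo) _ (iota_uniq 0 N).
  apply: le_trans; rewrite /index_iota subn0; apply: ler_sum => n _.
  have [->|sn] := eqVneq (s n) 0; first by rewrite powR0 ?powR_ge0// gt_eqF// (lt_le_trans _ p1).
  apply: powR_mono => //; rewrite Xe// innerZl fo// eqxx mulr1 cmodR.
  exact: ler_norm.
apply: (@le_lt_trans _ _ C%:E); last exact: ltry.
apply: lime_le.
  by apply: is_cvg_nneseries => n _ _; rewrite lee_fin powR_ge0.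
by apply: nearW => N; rewrite sumEFin lee_fin.
Qed.

Lemma cptD X Y : cpt X -> cpt Y -> cpt (fun u => X u + Y u).
Proof.
move=> [lX cX] [lY cY]; split=> [a u v|d d0].
  by rewrite lX lY scalerDr addrACA.
have d2 : 0 < d / 2 by rewrite divr_gt0.
have [F hF] := cX _ d2; have [G hG] := cY _ d2; exists (F ++ G) => u hu.
rewrite (le_trans (l2normD _ _))// [d]splitr mulrDl lerD//.
  by apply: hF => i iF; rewrite hu// mem_cat iF.
by apply: hG => i iG; rewrite hu// mem_cat iG orbT.
Qed.

Lemma cptZ (a : R[i]) X : cpt X -> cpt (fun u => a *: X u).
Proof.
move=> [lX cX]; split=> [b u v|d d0].
  by rewrite lX scalerDr !scalerA mulrC.
have k0 : 0 < cmod a + 1 by rewrite ltr_wpDl// cmod_ge0.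
have [F hF] := cX _ (divr_gt0 d0 k0); exists F => u /hF h.
rewrite l2normZ (le_trans (ler_wpM2l (cmod_ge0 a) h))// mulrA ler_wpM2r ?l2norm_ge0//.
by rewrite mulrC -mulrA ler_piMr ?(ltW d0)// mulrC ler_pdivrMr// mul1r lerDl.
Qed.

Lemma cpt_sum (T : Type) (s : seq T) (a : T -> R[i]) (X : T -> op R I) :
  (forall k, cpt (X k)) -> cpt (fun u => \sum_(k <- s) a k *: X k u).
Proof.
move=> cX; elim: s => [|k s IH].
  under eq_fun do rewrite big_nil; split=> [b u v|d d0].
    by rewrite scaler0 addr0.
  by exists [::] => u _; rewrite l2norm0 mulr_ge0 ?l2norm_ge0// ltW.
under eq_fun do rewrite big_cons; apply: cptD => //; exact: cptZ.
Qed.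

Lemma psumD p X Y : 1 <= p -> psum p X -> psum p Y -> psum p (fun u => X u + Y u).
Proof.
move=> p1 [C hC] [D hD]; exists (2 `^ p * (C + D)) => T x y xo yo s us.
apply: (@le_trans _ _ (\sum_(n <- s) 2 `^ p *
   (cmod (inner (X (x n)) (y n)) `^ p + cmod (inner (Y (x n)) (y n)) `^ p))).
  apply: ler_sum => n _; apply: le_trans (powR_addr p1 (cmod_ge0 _) (cmod_ge0 _)).
  by apply: powR_mono; rewrite ?cmod_ge0// innerDl cmodD.
rewrite -mulr_sumr ler_wpM2l ?powR_ge0// big_split lerD//; [exact: hC|exact: hD].
Qed.

Lemma psumZ p (a : R[i]) X : psum p X -> psum p (fun u => a *: X u).
Proof.
move=> [C hC]; exists (cmod a `^ p * C) => T x y xo yo s us.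
under eq_bigr do rewrite innerZl cmodM powRM ?cmod_ge0//.
rewrite -mulr_sumr ler_wpM2l ?powR_ge0//; exact: hC.
Qed.

Lemma psum_sum (T : Type) (s : seq T) p (a : T -> R[i]) (X : T -> op R I) :
  1 <= p -> (forall k, psum p (X k)) -> psum p (fun u => \sum_(k <- s) a k *: X k u).
Proof.
move=> p1 cX; elim: s => [|k s IH].
  under eq_fun do rewrite big_nil; exists 0 => T' x y xo yo t ut.
  rewrite big1// => n _; rewrite inner0l cmod0 powR0// gt_eqF//.
  exact: lt_le_trans p1.
have -> : (fun u => \sum_(j <- k :: s) a j *: X j u) =
    (fun u => a k *: X k u + \sum_(j <- s) a j *: X j u).
  by apply/funext => u; rewrite big_cons.
exact: psumD p1 (psumZ _ (cX k)) IH.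
Qed.

Section WeightedComposition.
Variables (c : I -> R[i]) (q q' : I -> I) (M : R).
Hypotheses (qK : cancel q q') (cM : forall j, cmod (c j) <= M).

(** A weighted shift: the basis vector at [q j] goes to [c j] times the one at [j]. *)
Definition wcomp : op R I := fun u => mkl2 (fun j => c j * u (q j)).

Let qi : injective q := can_inj qK.

Let wbound u (d : R) (s : seq I) : uniq s ->
  (forall j, sqmod (c j) * sqmod (u (q j)) <= d ^+ 2 * sqmod (u (q j))) ->
  \sum_(j <- s) sqmod (c j * u (q j)) <= d ^+ 2 * l2norm u ^+ 2.
Proof.
move=> us h; under eq_bigr do rewrite sqmodM.
apply: (@le_trans _ _ (\sum_(j <- s) d ^+ 2 * sqmod (u (q j)))).
  by apply: ler_sum => j _.
rewrite -mulr_sumr ler_wpM2l ?sqr_ge0//.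
by rewrite -(big_map q predT (fun i => sqmod (u i))) sum_le_l2norm// map_inj_uniq.
Qed.

Let M0 (j : I) : 0 <= M. Proof. exact: le_trans (cmod_ge0 (c j)) (cM j). Qed.

Let cM2 j : sqmod (c j) <= M ^+ 2.
Proof. by rewrite -cmod_sq lerXn2r// nnegrE ?cmod_ge0// (M0 j). Qed.

Lemma wcompE u j : wcomp u j = c j * u (q j).
Proof.
rewrite /wcomp (@mkl2E _ _ _ (M ^+ 2 * l2norm u ^+ 2))// => s us.
by apply: wbound => // k; rewrite ler_wpM2r ?sqmod_ge0.
Qed.

Lemma wcomp_lin : linear wcomp.
Proof. by move=> a u v; apply: l2P => j; rewrite !l2E !wcompE !l2E; ring. Qed.

Hypothesis c0 : forall d : R, 0 < d -> exists F : seq I, forall j, j \notin F -> cmod (c j) <= d.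

Lemma wcomp_cpt : cpt wcomp.
Proof.
split=> [|d d0]; first exact: wcomp_lin.
have [F hF] := c0 d0; exists (map q F) => u hu.
apply: ler_sq; first by rewrite mulr_ge0 ?l2norm_ge0// ltW.
rewrite exprMn; apply: l2norm_sq_le => s us.
under eq_bigr do rewrite wcompE; apply: wbound => // j.
have [jF|/hF jF] := boolP (j \in F); first by rewrite hu ?map_f// sqmod0 !mulr0.
rewrite ler_wpM2r ?sqmod_ge0// -cmod_sq lerXn2r// nnegrE ?cmod_ge0//.
exact: ltW.
Qed.

(** The weights |c_j| play the part of singular values, with the basis vectors at [q j] and [j] as
    singular systems. Cutting all y_n to one finite set G makes the sums finite. *)
Lemma wcomp_psum p C : 1 <= p ->
  (forall s, uniq s -> \sum_(j <- s) cmod (c j) `^ p <= C) -> psum p wcomp.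
Proof.
move=> p1 hC; exists (2 `^ p * (C + 1)) => T x y xo yo s us.
apply: sum_powR_perturb => // [n|d d0]; first exact: cmod_ge0.
have [_ [K hK]] := cpt_bounded wcomp_cpt.
have k0 : 0 < `|K| + 1 by rewrite ltr_wpDl.
have /choice[F hF] : forall n, exists F : seq I, forall F' : seq I, uniq F' -> {subset F <= F'} ->
    l2norm (y n - trunc F' (y n)) <= d / (`|K| + 1).
  by move=> n; have [F _ hF] := trunc_tail (y n) (divr_gt0 d0 k0); exists F.
pose G := undup (flatten [seq F n | n <- s]).
have uG : uniq G := undup_uniq _.
exists (fun n => cmod (inner (wcomp (x n)) (trunc G (y n)))); split=> [n|n ns|].
- exact: cmod_ge0.
- have -> : inner (wcomp (x n)) (y n) = inner (wcomp (x n)) (trunc G (y n)) +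
      inner (wcomp (x n)) (y n - trunc G (y n)) by rewrite -innerDr addrC subrK.
  rewrite (le_trans (cmodD _ _))// lerD2l.
  rewrite (le_trans (cauchy_schwarz _ _))//.
  have h1 : l2norm (wcomp (x n)) <= `|K| + 1.
    rewrite (le_trans (hK _))// (@le_trans _ _ `|K|) ?lerDl//.
    rewrite (le_trans (ler_wpM2r (l2norm_ge0 _) (ler_norm K)))// ler_piMr//.
    exact: xo.2.
  have h2 : l2norm (y n - trunc G (y n)) <= d / (`|K| + 1).
    apply: hF => // i iF; rewrite mem_undup; apply/flatten_mapP.
    by exists n.
  rewrite (le_trans (ler_pM (l2norm_ge0 _) (l2norm_ge0 _) h1 h2))//.
  by rewrite mulrC divfK// gt_eqF.
apply: le_trans (hC G uG).
pose w n j := cmod (inner (x n) (basis (q j))) * cmod (inner (y n) (basis j)).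
apply: (@le_trans _ _ (\sum_(n <- s) (\sum_(j <- G) w n j * cmod (c j)) `^ p)).
  apply: ler_sum => n _; apply: powR_mono => //; first exact: cmod_ge0.
  rewrite cmod_innerC /trunc inner_suml (le_trans (cmod_sum _ _ _))//.
  apply: ler_sum => j _; rewrite innerZl -inner_conj inner_basis wcompE.
  rewrite !(cmodM, cmod_conj) /w !inner_basis.
  by rewrite [cmod (c j) * _]mulrC mulrA [cmod (y n j) * _]mulrC.
apply: substochastic_powR => // [n k|k|n|k].
- by rewrite mulr_ge0 ?cmod_ge0.
- exact: cmod_ge0.
- exact: (orthosys_weight (orthosys_basis qi) (orthosys_basis (@inj_id I)) uG (xo.2 n) (yo.2 n)).
under eq_bigr => n _ do rewrite /w (cmod_innerC (x n)) (cmod_innerC (y n)).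
by apply: (orthosys_weight xo yo us); rewrite l2norm_basis.
Qed.

End WeightedComposition.

End Schatten.

(** * The derivative of exp(-tA) at 0 *)

Section Spectral.
Context {R : realType} {I : choiceType}.
Implicit Types (u v w : l2 R I).
Local Notation MT := (measurableTypeR R).

Lemma measurable_half_line : measurable (half_line : set MT).
Proof. exact: measurable_itv. Qed.

(** Meant for the spectral measures of E(C) u and u - E(C) u, which are the restrictions of that of
    u to C and to its complement. *)
Lemma integral_restricted_measure (nu mu : {measure set MT -> \bar R}) (D P : set MT)
    (f : MT -> \bar R) :
  measurable D -> measurable P -> measurable_fun D f ->
  (forall x, D x -> (0 <= f x)%E) ->
  (forall B : set MT, measurable B -> nu B = mu (B `&` P)) ->
  (\int[nu]_(x in D) f x = \int[mu]_(x in D `&` P) f x)%E.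
Proof.
move=> mD mP mf f0 h.
have mDP : measurable (D `&` P) by exact: measurableI.
have mDC : measurable (D `&` ~` P) by apply: measurableI => //; exact: measurableC.
have DE : D = (D `&` P) `|` (D `&` ~` P) by rewrite -setIUr setUv setIT.
rewrite {1}DE ge0_integral_setU//=; last 3 first.
- by rewrite -DE.
- by move=> x [[? _]|[? _]]; exact: f0.
- by rewrite disj_set2E setIACA setICr setI0.
rewrite [X in (_ + X)%E](_ : _ = 0%E) ?adde0.
  by apply: eq_measure_integral => B mB BD; rewrite h// setIidl// => x /BD[].
rewrite (@eq_measure_integral _ _ _ _ mzero) ?integral_measure_zero// => B mB BD.
by rewrite h// /mzero (_ : B `&` P = set0) ?measure0// -subset0 => x [/BD[_ ?]].
Qed.

(** Since e^x >= 1 + x, it is enough that (1 + x) (1 - x + x^2) = 1 + x^3 >= 1. *)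
Lemma exp_upper (x : R) : 0 <= x -> expR (- x) <= 1 - x + x ^+ 2.
Proof.
move=> x0; have x1 : 0 < 1 + x by lra.
rewrite expRN (le_trans (y := (1 + x)^-1))//.
  by rewrite lef_pV2 ?posrE ?expR_gt0// expR_ge1Dx.
rewrite -[leLHS]mul1r ler_pdivrMr//.
have := mulr_ge0 x0 (sqr_ge0 x); nra.
Qed.

Section Decomposition.
Variables (A : uop R I) (E : set R -> op R I) (mu : l2 R I -> {measure set MT -> \bar R}).
Hypotheses (sa : positive_selfadjoint A) (sd : spectral_decomposition A E mu).

Local Notation H := (half_line : set MT).
Let mH : measurable H := measurable_half_line.

Let Epr (B : set MT) : measurable B -> orthogonal_projection (E B).
Proof. by case: sd => -[h _ _ _ _] _ _; exact: h. Qed.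

Let muE (B : set MT) u : measurable B -> mu u B = (Re (inner (E B u) u))%:E.
Proof. by case: sd => -[_ _ _ _ h] _ _; exact: h. Qed.

Let EI (B C : set MT) u : measurable B -> measurable C -> E (B `&` C) u = E B (E C u).
Proof. by case: sd => -[_ _ _ h _] _ _ mB mC; rewrite h. Qed.

Let domP u : dom A u <-> (\int[mu u]_(l in H) (l ^+ 2)%:E < +oo)%E.
Proof. by case: sd. Qed.

Let qf u v : A (u, v) -> inner v u = (\int[mu u]_(l in H) l)%:C.
Proof. by case: sd => _ _; apply. Qed.

Let muT u : mu u setT = (l2norm u ^+ 2)%:E.
Proof.
rewrite muE//; case: sd => -[_ -> _ _ _] _ _.
by rewrite inner_id.
Qed.

Let muHC u : mu u (~` H) = 0%E.
Proof.
rewrite muE; last exact: measurableC.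
by case: sd => -[_ _ -> _ _] _ _; rewrite inner0l.
Qed.

Let muH u : mu u H = (l2norm u ^+ 2)%:E.
Proof.
rewrite -muT -(setUv H) measureU//; last 2 first.
- exact: measurableC.
- by rewrite setICr.
by rewrite [X in (_ + X)%E](_ : _ = 0%E) ?adde0//; exact: muHC.
Qed.

Let Einner (B C : set MT) u : measurable B -> measurable C ->
  inner (E B u) (E C u) = inner (E (B `&` C) u) u.
Proof.
move=> mB mC; have [_ _ h] := Epr mC.
by rewrite -h setIC EI.
Qed.

Let mu_cut (C B : set MT) u : measurable C -> measurable B ->
  mu (E C u) B = mu u (B `&` C).
Proof.
move=> mC mB; rewrite !muE//; last exact: measurableI.
by rewrite -EI// Einner//; [rewrite -setIA setIid|exact: measurableI].
Qed.

Let mu_cutC (C B : set MT) u : measurable C -> measurable B ->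
  mu (u - E C u) B = mu u (B `&` ~` C).
Proof.
move=> mC mB.
have mBC : measurable (B `&` C) by exact: measurableI.
have e : mu u (B `\` C) = (mu u B - mu u (B `&` C))%E.
  apply: measureD => //; apply: le_lt_trans (_ : mu u setT < +oo)%E; last by rewrite muT ltry.
  by apply: le_measure; [exact/mem_set|exact/mem_set/measurableT|exact: subsetT].
rewrite -[B `&` ~` C]/(B `\` C) e (muE _ mB) (muE _ mB) (muE _ mBC) -EFinB; congr EFin.
have [[lB _] _ _] := Epr mB.
rewrite (linB _ _ lB) -EI// innerBl !innerBr !Einner//.
rewrite -setIA setIid.
by rewrite subrr subr0 -raddfB.
Qed.

Let ml : measurable_fun H (fun l : MT => (l : R)%:E).
Proof. by apply/measurable_EFinP; exact: measurable_id. Qed.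

Let ml2 : measurable_fun H (fun l : MT => ((l : R) ^+ 2)%:E).
Proof. by apply/measurable_EFinP; apply: measurable_funX; exact: measurable_id. Qed.

Let H0 (l : MT) : H l -> 0 <= l.
Proof. by rewrite /half_line /= in_itv/= andbT. Qed.

Let int_cst u (k : R) : (mu u).-integrable H (EFin \o cst k).
Proof.
apply/integrableP; split; first by apply/measurable_EFinP; exact: measurable_cst.
rewrite (eq_integral (cst `|k|%:E))//.
by rewrite integral_cst// muH -EFinM ltry.
Qed.

(** The domain condition controls l^2; as the measure is finite, l <= 1 + l^2 passes this on to
    l. *)
Let int_id u v : A (u, v) -> (mu u).-integrable H (EFin \o id).
Proof.
move=> Auv; have /domP du : dom A u by exists v.
apply: (@le_integrable _ _ _ _ _ mH _ (fun l => (1 + l ^+ 2)%:E)) => //.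
  move=> l /H0 l0; rewrite lee_fin !ger0_norm//; last by rewrite addr_ge0// sqr_ge0.
  by have := sqr_ge0 (l - 1); nra.
rewrite (_ : (fun l => _) = (EFin \o cst 1) \+ (fun l : MT => ((l : R) ^+ 2)%:E))//.
apply: (integrableD mH (int_cst u 1)).
apply/integrableP; split => //.
by under eq_integral do rewrite gee0_abs ?lee_fin ?sqr_ge0//.
Qed.

Let int_exp u (t : R) : 0 <= t -> (mu u).-integrable H (EFin \o (fun l => expR (- t * l))).
Proof.
move=> t0; apply: (@le_integrable _ _ _ _ _ mH _ (EFin \o cst 1)); last exact: int_cst.
  by apply/measurable_EFinP; apply: measurableT_comp => //.
move=> l /H0 l0; rewrite lee_fin !ger0_norm ?expR_ge0//=.
by rewrite expR_le1 mulNr oppr_le0 mulr_ge0.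
Qed.

(** The graph equals its adjoint, and an adjoint is visibly a linear subspace. *)
Let A_sub u v u' v' : A (u, v) -> A (u', v') -> A (u - u', v - v').
Proof.
have [_ aA _] := sa; rewrite -aA => h h' a b ab /=.
by rewrite !innerBr (h a b ab) (h' a b ab).
Qed.

Let A_sym u v u' v' : A (u, v) -> A (u', v') -> inner v' u = inner u' v.
Proof. by have [_ aA _] := sa; rewrite -{1}aA => h h'; exact: (h u' v'). Qed.

(* Cutting off [u] at the spectral level [N] turns the tail of the quadratic
   form into the inner product [<A u, E(]N, oo[) u>]. *)
Lemma tail_bound u v (N : R) : A (u, v) -> 0 < N ->
  \int[mu u]_(l in H `&` `]N, +oo[%classic) l <= l2norm v ^+ 2 / N.
Proof.
move=> Auv N0; pose C : set MT := `]N, +oo[%classic.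
have mC : measurable C by exact: measurable_itv.
have mHC : measurable (H `&` C) by exact: measurableI.
have mCc : measurable (~` C) by exact: measurableC.
rewrite -/C; set J := Rintegral _ _ _.
have cut (f : MT -> \bar R) := @integral_restricted_measure (mu (E C u)) (mu u) H C f mH mC.
have cutC (f : MT -> \bar R) := @integral_restricted_measure (mu (u - E C u)) (mu u) H (~` C) f mH mCc.
have nn (l : MT) : H l -> (0 <= (l : R)%:E)%E by move=> /H0; rewrite lee_fin.
have nn2 (l : MT) : H l -> (0 <= ((l : R) ^+ 2)%:E)%E by rewrite lee_fin sqr_ge0.
have /domP du : dom A u by exists v.
have [x' Ax'] : dom A (E C u).
  apply/domP; rewrite (cut _ ml2 nn2 (fun B mB => mu_cut u mC mB)).
  by apply: le_lt_trans du; apply: ge0_subset_integral => // l _; rewrite lee_fin sqr_ge0.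
have Ax := A_sub Auv Ax'; set w' := E C u in Ax Ax'; set w := u - w' in Ax; set x := v - x' in Ax.
have wE : w + w' = u by rewrite subrK.
have xE : x + x' = v by rewrite subrK.
have q' : inner x' w' = J%:C.
  by rewrite (qf Ax') /J /Rintegral (cut _ ml nn (fun B mB => mu_cut u mC mB)).
have q : inner x w = (\int[mu u]_(l in H `&` ~` C) l)%:C.
  by rewrite (qf Ax) /Rintegral (cutC _ ml nn (fun B mB => mu_cutC u mC mB)).
have HE : (H `&` ~` C) `|` (H `&` C) = H by rewrite -setIUr setUC setUv setIT.
have split : \int[mu u]_(l in H) l = \int[mu u]_(l in H `&` ~` C) l + J.
  rewrite -[in LHS]HE Rintegral_setU//.
  - exact: measurableI.
  - by rewrite HE; exact: int_id Auv.
  by rewrite disj_set2E setIACA setICl setI0.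
clearbody w x.
(* The quadratic form is additive over the two spectral pieces, so the cross terms <x, w'> and <x',
   w> cancel; by symmetry of A they are conjugate to each other. *)
have cross : Re (inner x w') = 0.
  have := qf Auv; rewrite split -{1}wE -{1}xE innerDl !innerDr q q' (A_sym Ax Ax') -(inner_conj x w').
  by case: (inner x w') => a b [/= h _]; lra.
have vw : Re (inner v w') = J.
  by rewrite -xE innerDl q'; move: cross; case: (inner x w') => a b /= ->; rewrite add0r.
have J0 : 0 <= J by apply: Rintegral_ge0 => l [/H0].
have CJ : N * l2norm w' ^+ 2 <= J.
  have -> : l2norm w' ^+ 2 = fine (mu u (H `&` C)).
    have := Einner u mC mC; rewrite setIid inner_id => e.
    rewrite (_ : H `&` C = C); last first.
      by apply/setIidr => l; rewrite /C /half_line /= !in_itv/= !andbT => /ltW; apply: le_trans; exact: ltW.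
    by rewrite (muE u mC) -e.
  rewrite -Rintegral_cst//; apply: le_Rintegral => //.
  - by apply: integrableS (int_cst u N) => //.
  - by apply: integrableS (int_id Auv) => //.
  by move=> l [_]; rewrite /C /= in_itv/= andbT => /ltW.
(* Together with N |w'|^2 <= J this gives N J^2 <= |v|^2 J, and J cancels. *)
have JJ : J ^+ 2 <= l2norm v ^+ 2 * l2norm w' ^+ 2.
  rewrite -exprMn lerXn2r ?nnegrE ?mulr_ge0 ?l2norm_ge0//.
  by rewrite -vw (le_trans (ler_norm _))// (le_trans (Re_le_cmod _))// cauchy_schwarz.
rewrite ler_pdivlMr//; have [->|Jn] := eqVneq J 0; first by rewrite mul0r sqr_ge0.
have Jp : 0 < J by rewrite lt_def Jn.
rewrite -(ler_pM2l Jp).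
have h1 := ler_wpM2l (sqr_ge0 (l2norm v)) CJ.
have h2 := ler_wpM2l (ltW N0) JJ.
by nra.
Qed.

(** Below, (1 - e^(-tl)) / t <= l. Above, the second order bound on the exponential costs t l^2 <= t
    N^2 for l <= N, and the range l > N is left to [tail_bound]. The error terms do not mention the
    measure. *)
Lemma spectral_estimate u v (t N c : R) : A (u, v) -> 0 < t -> 0 < N ->
  \int[mu u]_(l in H) expR (- t * l) = c ->
  t^-1 * (l2norm u ^+ 2 - c) <= Re (inner v u) <=
  t^-1 * (l2norm u ^+ 2 - c) + t * N ^+ 2 * l2norm u ^+ 2 + l2norm v ^+ 2 / N.
Proof.
move=> Auv t0 N0 cE; pose C : set MT := `]N, +oo[%classic.
have mC : measurable C by exact: measurable_itv.
have iid := int_id Auv; have iexp := int_exp u (ltW t0).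
have cstE k : \int[mu u]_(l in H) k = k * l2norm u ^+ 2.
  by rewrite Rintegral_cst// muH.
rewrite (qf Auv) /=.
have iexp' : (mu u).-integrable H (EFin \o (fun l => t^-1 * (1 - expR (- t * l)))).
  have := integrableZl mH t^-1 (integrableB mH (int_cst u 1) iexp).
  by apply: eq_integrable.
have e1 : \int[mu u]_(l in H) (t^-1 * (1 - expR (- t * l))) = t^-1 * (l2norm u ^+ 2 - c).
  rewrite RintegralZl//; last by have := integrableB mH (int_cst u 1) iexp; apply: eq_integrable.
  by rewrite (RintegralB mH (int_cst u 1) iexp) [X in X - _](cstE 1) mul1r cE.
have tV : 0 < t^-1 by rewrite invr_gt0.
apply/andP; split.
  rewrite -e1; apply: le_Rintegral => // l _.
  rewrite mulrC ler_pdivrMr// lerBlDl -lerBlDr mulrC -mulNr.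
  exact: expR_ge1Dx.
apply: le_trans (_ : t^-1 * (l2norm u ^+ 2 - c) + t * N ^+ 2 * l2norm u ^+ 2 +
    \int[mu u]_(l in H `&` C) l <= _); last first.
  by rewrite lerD2l; exact: tail_bound.
rewrite -e1 -cstE Rintegral_mkcondr.
have ipat : (mu u).-integrable H (EFin \o ((fun l => l) \_ C)).
  apply: (le_integrable mH _ _ iid).
    apply/measurable_EFinP; by apply/(measurable_restrict _ mC mH); exact: measurable_id.
  move=> l _ /=; rewrite /patch; case: ifP => _ //.
  by rewrite normr0 lee_fin.
have icst := int_cst u (t * N ^+ 2).
have isum : (mu u).-integrable H (EFin \o (fun l => t^-1 * (1 - expR (- t * l)) + t * N ^+ 2)).
  by have := integrableD mH iexp' icst; apply: eq_integrable.
rewrite -RintegralD// -RintegralD//; apply: le_Rintegral => //.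
  by have := integrableD mH isum ipat; apply: eq_integrable.
move=> l /H0 l0; rewrite /patch.
have low : 0 <= t^-1 * (1 - expR (- t * l)).
  by rewrite mulr_ge0 ?(ltW tV)// subr_ge0 expR_le1 mulNr oppr_le0 mulr_ge0// ltW.
have tN : 0 <= t * N ^+ 2 by rewrite mulr_ge0 ?sqr_ge0// ltW.
case: ifPn => lC; first by lra.
have lN : l <= N.
  move: lC; apply: contraNT; rewrite -ltNge => h.
  by apply: mem_set; rewrite /C /= in_itv/= h.
rewrite -[X in _ <= _ + X]/(0 : R) addr0.
have := exp_upper (mulr_ge0 (ltW t0) l0); rewrite -mulNr => h.
have : l - t * l ^+ 2 <= t^-1 * (1 - expR (- t * l)).
  by rewrite -(ler_pM2l t0) mulVKf ?gt_eqF//; lra.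
have : t * l ^+ 2 <= t * N ^+ 2 by rewrite ler_wpM2l ?(ltW t0)// lerXn2r// nnegrE ltW.
lra.
Qed.

End Decomposition.

(* [is_exp] provides a spectral measure for each [t] separately, hence the
   estimates above are uniform in the measure. *)
Lemma exp_derivative (A : uop R I) (S : R -> op R I) u v :
  positive_selfadjoint A -> A (u, v) -> (forall t, 0 < t -> is_exp A t (S t)) ->
  inner v u = (Re (inner v u))%:C /\
  (forall t, 0 < t -> inner (S t u) u = (Re (inner (S t u) u))%:C) /\
  t^-1 * (l2norm u ^+ 2 - Re (inner (S t u) u)) @[t --> 0^'+] --> Re (inner v u).
Proof.
move=> sa Auv hS.
have hS' t : 0 < t -> exists E mu, spectral_decomposition A E mu /\
    inner (S t u) u = (\int[mu u]_(l in half_line) expR (- t * l))%:C.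
  by move=> /hS[_ [E [mu [h1 h2]]]]; exists E, mu.
split.
  have [E [mu [[_ _ h] _]]] := hS' 1 ltr01.
  by rewrite (h _ _ Auv).
split; first by move=> t /hS'[E [mu [_ ->]]].
apply/cvgrPdist_le => d d0.
have d2 : 0 < d / 2 by rewrite divr_gt0.
(* The level N is fixed first, making the spectral tail at most d / 2; then t < d / (2 K) handles
   the term t N^2 |u|^2. *)
pose N := 2 * (l2norm v ^+ 2 + 1) / d.
have v1 : 0 < l2norm v ^+ 2 + 1 by rewrite ltr_wpDl// sqr_ge0.
have N0 : 0 < N by rewrite divr_gt0// mulr_gt0.
have vN : l2norm v ^+ 2 / N <= d / 2.
  have -> : d / 2 = (l2norm v ^+ 2 + 1) / N by rewrite /N; field; rewrite !gt_eqF.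
  by rewrite ler_pM2r ?invr_gt0// lerDl.
pose K := N ^+ 2 * l2norm u ^+ 2 + 1.
have K0 : 0 < K by rewrite ltr_wpDl// mulr_ge0 ?sqr_ge0.
near=> t.
have t0 : 0 < t by near: t; exact: nbhs_right_gt.
have tK : t < d / 2 / K.
  by near: t; apply: nbhs_right_lt; rewrite divr_gt0.
have [E [mu [h1 ->]]] := hS' t t0.
have /= /andP[a b] := spectral_estimate sa h1 Auv t0 N0 erefl.
have : t * N ^+ 2 * l2norm u ^+ 2 <= d / 2.
  move: tK; rewrite ltr_pdivlMr// => tK; apply: le_trans (ltW tK).
  by rewrite -mulrA ler_wpM2l ?(ltW t0)// /K lerDl.
rewrite ger0_norm ?subr_ge0// => c; lra.
Unshelve. all: by end_near. Qed.

End Spectral.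

(** * Averaging over the group *)

Section Coordinates.
Context {R : realType}.

Lemma mkl2_inj {I J : choiceType} (q : J -> I) (u : l2 R I) j :
  injective q -> (mkl2 (fun j => u (q j)) : l2 R J) j = u (q j).
Proof.
move=> qi; rewrite (@mkl2E _ _ _ (l2norm u ^+ 2))// => s us.
by rewrite -(big_map q predT (fun i => sqmod (u i))) sum_le_l2norm// map_inj_uniq.
Qed.

Lemma mkl2_0 {I : choiceType} : mkl2 (fun _ : I => 0 : R[i]) = 0.
Proof.
apply: l2P => i; rewrite (@mkl2E _ _ _ 0)// => s _.
by rewrite big1// => j _; rewrite sqmod0.
Qed.

Lemma sum_subset {T : eqType} (s t : seq T) (f : T -> R) : uniq s -> uniq t ->
  {subset s <= t} -> (forall k, 0 <= f k) -> \sum_(k <- s) f k <= \sum_(k <- t) f k.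
Proof.
move=> + + + f0; elim: s t => [|a s IH] t; first by rewrite big_nil sumr_ge0.
move=> /= /andP[as_ us] ut st; have ta : a \in t by apply: st; rewrite mem_head.
rewrite big_cons (big_rem a ta) /= lerD2l; apply: IH => //; first exact: rem_uniq.
move=> x xs; rewrite mem_rem_uniq// inE; apply/andP; split; last by rewrite st// in_cons xs orbT.
by apply: contraNneq as_ => <-.
Qed.

Lemma bounded_opP {I : choiceType} (T : op R I) : bounded_op T ->
  exists2 M : R, 0 <= M & forall u, l2norm (T u) <= M * l2norm u.
Proof.
move=> [_ [M hM]]; exists `|M| => // u.
by rewrite (le_trans (hM u))// ler_wpM2r ?l2norm_ge0// ler_norm.
Qed.

Lemma bounded_comp {I : choiceType} (S T : op R I) : bounded_op S -> bounded_op T ->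
  bounded_op (S \o T).
Proof.
move=> bS bT; have [M M0 hM] := bounded_opP bS; have [N N0 hN] := bounded_opP bT.
split=> [a u v /=|]; first by rewrite bT.1 bS.1.
by exists (M * N) => u /=; rewrite (le_trans (hM _))// -mulrA ler_wpM2l.
Qed.

Lemma vN_sub {I : choiceType} (S : set (op R I)) T : S T -> bounded_op T -> vN S T.
Proof. by move=> ST bT; split=> // x [_ /(_ _ ST)]. Qed.

Lemma vN_comp {I : choiceType} (S : set (op R I)) T T' : vN S T -> vN S T' -> vN S (T \o T').
Proof.
move=> [bT hT] [bT' hT']; split=> [|x Sx]; first exact: bounded_comp.
by rewrite -compA hT'// compA hT.
Qed.

End Coordinates.

Section Group.
Context {R : realType} {G : groupType}.
Local Notation H := (l2 R G).
Local Notation H2 := (l2 R (G * G)%type).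
Implicit Types (g h k s r : G) (u v : H) (x y : op R G) (z : H2) (q : (G * G)%type).

Lemma lambdaE s u g : lambda s u g = u (s^-1 * g)%g.
Proof. by rewrite /lambda mkl2_inj//; exact: mulgI. Qed.

Lemma lambda_bounded s : bounded_op (lambda (R := R) s).
Proof.
split=> [a u v|]; first by apply: l2P => g; rewrite !l2E !lambdaE.
exists 1 => u; rewrite mul1r; apply: ler_sq; first exact: l2norm_ge0.
apply: l2norm_sq_le => t ut; under eq_bigr do rewrite lambdaE.
rewrite -(big_map (fun g => s^-1 * g)%g predT (fun i => sqmod (u i))) sum_le_l2norm//.
by rewrite map_inj_uniq//; exact: mulgI.
Qed.

Lemma LG_lambda s : LG (lambda (R := R) s).
Proof. by apply: vN_sub; [exists s|exact: lambda_bounded]. Qed.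

Lemma lambda1 : lambda 1%g = id :> op R G.
Proof. by apply/funext => u; apply: l2P => g; rewrite lambdaE invg1 mul1g. Qed.

Lemma LG_id : LG (id : op R G). Proof. by rewrite -lambda1; exact: LG_lambda. Qed.

Lemma LG0 : LG ((fun=> 0) : op R G).
Proof.
split=> [|x [[lx _] _]].
  split=> [a u v|]; first by rewrite scaler0 addr0.
  by exists 0 => u; rewrite l2norm0 mul0r.
by apply/funext => u /=; rewrite (lin0 lx).
Qed.

Lemma lambda_basis s g : lambda s (basis g) = basis (s * g)%g :> H.
Proof.
apply: l2P => h; by rewrite lambdaE !basisE (can2_eq (mulVKg s) (mulKg s)).
Qed.

Lemma tauE x : tau x = x vec1 1%g.
Proof. by rewrite /tau inner_basis. Qed.

Lemma sliceE z k g : slice z k g = z (g, k).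
Proof. by rewrite /slice (@mkl2_inj R (G * G)%type G (fun g => (g, k)))// => ? ? []. Qed.

Lemma sum_slice z (t : seq G) : uniq t ->
  \sum_(h <- t) l2norm (slice z h) ^+ 2 <= l2norm z ^+ 2.
Proof.
move=> ut; suff : forall d : R, 0 < d -> \sum_(h <- t) l2norm (slice z h) ^+ 2 <= l2norm z ^+ 2 + d.
  by move/ler_addgt0Pr.
(* Each slice is approximated by a finite sum up to d / n, so the errors total at most d and the
   finite sums combine into one over distinct pairs. *)
move=> d d0; pose n : R := (size t)%:R + 1.
have n0 : 0 < n by rewrite ltr_wpDl.
have /choice[S hS] : forall h, exists s : seq G, uniq s /\
    l2norm (slice z h) ^+ 2 - d / n < \sum_(g <- s) sqmod (slice z h g).
  by move=> h; have [s us hs] := l2norm_approx (slice z h) (divr_gt0 d0 n0); exists s.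
apply: (@le_trans _ _ (\sum_(h <- t) (\sum_(g <- S h) sqmod (z (g, h)) + d / n))).
  apply: ler_sum => h _; rewrite -lerBlDr; apply: ltW; have [_] := hS h.
  by under eq_bigr do rewrite sliceE.
rewrite big_split /= lerD//; last first.
  rewrite big_const_seq count_predT iter_addr_0 -[_ *+ _]mulr_natl mulrCA ler_piMr ?(ltW d0)//.
  by rewrite ler_pdivrMr// mul1r lerDl.
have -> : \sum_(h <- t) \sum_(g <- S h) sqmod (z (g, h)) =
    \sum_(p <- [seq (g, h) | h <- t, g <- S h]) sqmod (z p) by rewrite big_allpairs_dep.
apply: sum_le_l2norm; apply: allpairs_uniq_dep => //.
  by move=> h _; have [] := hS h.
by move=> [h g] [h' g'] _ _ /= [-> ->].
Qed.

Section Tensor.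
Variables (x : op R G) (s : G).
Hypothesis bx : bounded_op x.

Let tensor_bound (M : R) z (t : seq (G * G)%type) : 0 <= M ->
  (forall u, l2norm (x u) <= M * l2norm u) -> uniq t ->
  \sum_(q <- t) sqmod (x (slice z (s^-1 * q.2)%g) q.1) <= M ^+ 2 * l2norm z ^+ 2.
Proof.
(* The index list is enlarged to a rectangle, so that it can be summed slice by slice. *)
move=> M0 hM ut; pose t1 := undup (map fst t); pose t2 := undup (map snd t).
apply: (@le_trans _ _ (\sum_(q <- [seq (g, h) | h <- t2, g <- t1])
    sqmod (x (slice z (s^-1 * q.2)%g) q.1))).
  apply: sum_subset => //; last by move=> q; exact: sqmod_ge0.
    apply: allpairs_uniq; rewrite ?undup_uniq// => -[h g] [h' g'] _ _ /= [-> ->]//.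
  move=> [g h] qt; apply/allpairsP; exists (h, g); split=> //=.
    by rewrite mem_undup; apply/mapP; exists (g, h).
  by rewrite mem_undup; apply/mapP; exists (g, h).
rewrite big_allpairs_dep /=.
apply: (@le_trans _ _ (\sum_(h <- t2) M ^+ 2 * l2norm (slice z (s^-1 * h)%g) ^+ 2)).
  apply: ler_sum => h _; rewrite (le_trans (sum_le_l2norm _ (undup_uniq _)))//.
  by rewrite -exprMn lerXn2r// nnegrE ?mulr_ge0 ?l2norm_ge0.
rewrite -mulr_sumr ler_wpM2l ?sqr_ge0//.
rewrite -(big_map (fun h => s^-1 * h)%g predT (fun h => l2norm (slice z h) ^+ 2)).
by apply: sum_slice; rewrite map_inj_uniq ?undup_uniq//; exact: mulgI.
Qed.

Lemma tensor_lambdaE z q :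
  tensor_op x (lambda s) z q = x (slice z (s^-1 * q.2)%g) q.1.
Proof.
have [M M0 hM] := bounded_opP bx.
have inE' p : lambda s (mkl2 (fun h => x (slice z h) p.1)) p.2 = x (slice z (s^-1 * p.2)%g) p.1.
  rewrite lambdaE (@mkl2E _ _ _ (M ^+ 2 * l2norm z ^+ 2))// => t ut.
  apply: (@le_trans _ _ (\sum_(h <- t) M ^+ 2 * l2norm (slice z h) ^+ 2)).
    apply: ler_sum => h _; rewrite (le_trans (coord_le _ _))//.
    by rewrite -exprMn lerXn2r// nnegrE ?mulr_ge0 ?l2norm_ge0.
  by rewrite -mulr_sumr ler_wpM2l ?sqr_ge0// sum_slice.
rewrite /tensor_op (@mkl2E _ _ _ (M ^+ 2 * l2norm z ^+ 2)) ?inE'// => t ut.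
by under eq_bigr do rewrite inE'; exact: tensor_bound.
Qed.

Lemma tensor_lambda_bounded : bounded_op (tensor_op x (lambda s)).
Proof.
have [M M0 hM] := bounded_opP bx; split=> [a z z'|].
  apply: l2P => q; transitivity (a * x (slice z (s^-1 * q.2)%g) q.1 + x (slice z' (s^-1 * q.2)%g) q.1).
    apply: etrans (tensor_lambdaE (a *: z + z') q) _.
    rewrite (_ : slice (a *: z + z') _ = a *: slice z (s^-1 * q.2)%g + slice z' (s^-1 * q.2)%g).
      by rewrite bx.1.
    apply: l2P => g; apply: etrans (sliceE _ _ _) _.
    exact: esym (congr2 +%R (congr1 ( *%R a) (sliceE z _ g)) (sliceE z' _ g)).
  exact: esym (congr2 +%R (congr1 ( *%R a) (tensor_lambdaE z q)) (tensor_lambdaE z' q)).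
exists M => z; apply: ler_sq; first by rewrite mulr_ge0 ?l2norm_ge0.
rewrite exprMn; apply: l2norm_sq_le => t ut.
by under eq_bigr do rewrite tensor_lambdaE; exact: tensor_bound.
Qed.

End Tensor.

Lemma LG2_tensor x s : LG x -> LG2 (tensor_op x (lambda s)).
Proof.
move=> Lx; have bx : bounded_op x by case: Lx.
apply: vN_sub; last exact: tensor_lambda_bounded.
by exists x, (lambda s); split=> //; exact: LG_lambda.
Qed.

Lemma comult_lambdaE s z q : comult (lambda s) z q = z (s^-1 * q.1, s^-1 * q.2)%g.
Proof.
have e p : lambda s (mkl2 (fun g => z (g, g * p.1^-1 * p.2)%g)) p.1 = z (s^-1 * p.1, s^-1 * p.2)%g.
  rewrite lambdaE (@mkl2_inj R (G * G)%type G (fun g => (g, g * p.1^-1 * p.2)%g)) ?mulgK//.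
  by move=> ? ? [].
rewrite /comult (_ : (fun p => _) = fun p => z (s^-1 * p.1, s^-1 * p.2)%g); last first.
  by apply/funext => p; exact: e.
rewrite (@mkl2_inj R (G * G)%type (G * G)%type (fun p => (s^-1 * p.1, s^-1 * p.2)%g))//.
by move=> [a b] [c d] /= [/mulgI -> /mulgI ->].
Qed.

Lemma comult_id : comult id = id :> op R (G * G)%type.
Proof.
by rewrite -lambda1; apply/funext => z; apply: l2P => -[g h]; rewrite comult_lambdaE /= invg1 !mul1g.
Qed.

(** On the second leg, s (x) s is the permutation matrix of s, so each row has a single non-zero
    block. *)
Lemma block_lambda s h k :
  block (comult (lambda s)) h k = if (s^-1 * h == k)%g then lambda s else (fun=> 0) :> op R G.
Proof.
apply/funext => u; rewrite /block.
have embE p : mkl2 (fun q : (G * G)%type => if q.2 == k then u q.1 else 0) p =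
    if p.2 == k then u p.1 else 0.
  rewrite (@mkl2E _ _ _ (l2norm u ^+ 2))// => t ut.
  rewrite (eq_bigr (fun q => if q.2 == k then sqmod (u q.1) else 0)) => [|q _]; last first.
    by case: ifP; rewrite ?sqmod0.
  rewrite -big_mkcond /= -big_filter -(big_map fst predT (fun g => sqmod (u g))).
  apply: sum_le_l2norm; rewrite map_inj_in_uniq ?filter_uniq//.
  move=> [a b] [c d]; rewrite !mem_filter /= => /andP[/eqP -> _] /andP[/eqP -> _] -> //.
under [X in mkl2 X]eq_fun do rewrite comult_lambdaE embE /=.
by case: ifP => _; [|exact: mkl2_0].
Qed.

Lemma amplify_lambda (phi : op R G -> op R G) s : linear_on_LG phi -> bounded_op (phi (lambda s)) ->
  amplify phi (comult (lambda s)) = tensor_op (phi (lambda s)) (lambda s).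
Proof.
move=> lphi bphi; have phi0 : phi (fun=> 0) = (fun=> 0).
  have := lphi (-1) _ _ LG0 LG0.
  under [X in phi X]eq_fun do rewrite scaler0 addr0.
  by move=> ->; apply/funext => u; rewrite scaleN1r addNr.
apply/funext => z; apply: l2P => q; rewrite tensor_lambdaE//.
rewrite /amplify (_ : (fun p => _) = tensor_op (phi (lambda s)) (lambda s) z); last first.
  apply/funext => p; rewrite tensor_lambdaE// (@csum_single _ _ _ (s^-1 * p.2)%g).
    by rewrite block_lambda eqxx.
  by move=> k kn; rewrite block_lambda eq_sym (negPf kn) phi0.
rewrite /mkl2; case: (tensor_op _ _ z) (tensor_lambdaE s bphi z q) => f /= fs <-.
by rewrite insubdK.
Qed.

Section Averaging.
Variable E : op R (G * G)%type -> op R G.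
Hypothesis hE : averaging_expectation E.

(** The coordinate at h is tau(h^-1 E(X)). The bimodule property moves h^-1 inside as h^-1 (x) h^-1,
    and trace preservation leaves tau(h^-1 x) tau(h^-1 s), which vanishes unless h = s. *)
Lemma expectation_tensor x s : LG x ->
  E (tensor_op x (lambda s)) vec1 = x vec1 s *: basis s.
Proof.
move=> Lx; have [_ _ _ [_ Ebi] Etau] := hE.
have LX := LG2_tensor s Lx.
apply: l2P => h; rewrite l2ZE basisE.
have -> : E (tensor_op x (lambda s)) vec1 h =
    tau (lambda h^-1%g \o E (tensor_op x (lambda s)) \o id).
  by rewrite tauE /= lambdaE invgK mulg1.
rewrite -Ebi//; [|exact: LG_lambda|exact: LG_id].
have Lhx : LG (lambda h^-1%g \o x) by apply: vN_comp => //; exact: LG_lambda.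
have bx : bounded_op x by case: Lx.
have bhx : bounded_op (lambda h^-1%g \o x) by case: Lhx.
have -> : comult (lambda h^-1%g) \o tensor_op x (lambda s) \o comult id =
    tensor_op (lambda h^-1%g \o x) (lambda (h^-1 * s)%g).
  rewrite comult_id; apply/funext => z; apply: l2P => q /=.
  by rewrite comult_lambdaE !tensor_lambdaE//= lambdaE invgM !invgK mulgA.
rewrite Etau; last exact: LG2_tensor.
rewrite /tau2 inner_basis tensor_lambdaE//= lambdaE invgK !mulg1 invgM invgK.
have -> : slice (basis (1, 1)%g) (s^-1 * h)%g = (h == s)%:R *: (vec1 : H).
  apply: l2P => g; rewrite sliceE l2ZE !basisE xpair_eqE -natrM mulnb andbC.
  congr ((_ && _)%:R); apply/idP/idP => /eqP => [e|->]; last by rewrite mulVg.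
  by rewrite -(mulVKg s h) e mulg1.
have [->|ne] := eqVneq h s; first by rewrite scale1r mulr1.
by rewrite scale0r (lin0 bx.1) mulr0.
Qed.

Section Generator.
Variables (Phi : R -> op R G -> op R G) (A : uop R G).
Hypotheses (hPhi : is_qms Phi) (hA : is_generator Phi A) (CGA : CG `<=` dom A).

Definition symbol g : R[i] := app A (basis g) g.

Lemma CG_basis g : CG (basis g : H).
Proof.
apply: (@sub_finite_set _ _ [set g]) => //.
move=> h /= /negP hb; apply: contrapT => /eqP hg; apply: hb.
by rewrite basisE (negPf hg).
Qed.

Lemma app_dom u : dom A u -> A (u, app A u).
Proof. by move=> [v Av]; exact: (@xgetPex _ 0 [set v | A (u, v)] (ex_intro _ v Av)). Qed.

Lemma averaged_limit g :
  l2norm ((t^-1)%:C *: (basis g - averaged E Phi t (lambda g) vec1) - symbol g *: basis g)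
    @[t --> 0^'+] --> (0 : R).
Proof.
have [sa hS] := hA.
(* For t < 0 the operator [id] is a mere placeholder. *)
have /choice[S hS'] : forall t : R, exists S : op R G, 0 <= t -> is_exp A t S /\
    forall x, LG x -> S (x vec1) = Phi t x vec1.
  move=> t; have [t0|t0] := boolP (0 <= t); last by exists id.
  by have [S h] := hS t t0; exists S.
have Ag := app_dom (CGA (CG_basis g)).
have [psiR [SR lim]] := exp_derivative sa Ag (fun t t0 => (hS' t (ltW t0)).1).
rewrite inner_basis -/(symbol g) in psiR lim.
(* Psi_t(g) is a real multiple of g, so the vector limit reduces to the scalar limit of
   [exp_derivative]. *)
have key t : 0 < t -> averaged E Phi t (lambda g) vec1 =
    (Re (inner (S t (basis g)) (basis g)))%:C *: basis g.
  move=> t0; have t0' := ltW t0; have Lg := qms_LG hPhi t0' (LG_lambda g).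
  rewrite /averaged amplify_lambda; [|exact: qms_linear|by case: Lg].
  rewrite expectation_tensor//; congr (_ *: _).
  rewrite -(hS' t t0').2; last exact: LG_lambda.
  by rewrite lambda_basis mulg1 -inner_basis; exact: SR.
have : (`|t^-1 * (l2norm (basis g) ^+ 2 - Re (inner (S t (basis g)) (basis g))) - Re (symbol g)|)
    @[t --> 0^'+] --> (0 : R).
  have := cvg_norm (cvgB lim (cvg_cst (Re (symbol g)))).
  by rewrite subrr normr0; exact.
apply: cvg_trans; apply: near_eq_cvg; near=> t.
have t0 : 0 < t by near: t; exact: nbhs_right_gt.
rewrite key//; move: psiR; set r := Re (symbol g) => ->; set c := Re _.
have -> : (t^-1)%:C *: (basis g - c%:C *: basis g) - r%:C *: basis g =
    (t^-1 * (1 - c) - r)%:C *: (basis g : H).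
  have -> : (t^-1 * (1 - c) - r)%:C = (t^-1)%:C * (1 - c%:C) - r%:C.
    by apply/eqP; rewrite eq_complex /=; apply/andP; split; apply/eqP; ring.
  by rewrite scalerBl -scalerA scalerBl scale1r.
by rewrite l2normZ l2norm_basis mulr1 expr1n cmodR.
Unshelve. all: by end_near. Qed.

End Generator.
End Averaging.
End Group.

(** * Gradients of multipliers *)

Section UnboundedOperators.
Context {R : realType} {I : choiceType}.
Implicit Types (A : uop R I) (u v : l2 R I).

(** Both values satisfy the adjoint relation, so their difference w is orthogonal to the dense
    domain; then |w| <= |w - x| for every x in it, which can be made arbitrarily small. *)
Lemma positive_selfadjoint_single A u v v' : positive_selfadjoint A ->
  A (u, v) -> A (u, v') -> v = v'.
Proof.
move=> [dA aA _] h h'; apply/eqP; rewrite -subr_eq0; apply/eqP/l2norm_eq0/eqP.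
rewrite eq_le l2norm_ge0 andbT; set w := v - v'.
have perp x : dom A x -> inner x w = 0.
  move=> [y Axy]; rewrite innerBr.
  have h1 : adjoint A (u, v) by rewrite aA.
  have h2 : adjoint A (u, v') by rewrite aA.
  by rewrite -(h1 x y Axy) -(h2 x y Axy) subrr.
suff : forall e : R, 0 < e -> l2norm w <= 0 + e by move/ler_addgt0Pr.
move=> e e0; have [x /perp px xe] := dA w e e0; rewrite add0r.
apply: le_trans (ltW xe); apply: ler_sq; first exact: l2norm_ge0.
have wx : inner w (- x) = 0 by rewrite innerNr -(inner_conj x) px conjc0 oppr0.
by rewrite (l2norm_pyth wx) lerDl sqr_ge0.
Qed.

Lemma app_unique A u v : positive_selfadjoint A -> A (u, v) -> app A u = v.
Proof.
move=> sA Auv; apply: (positive_selfadjoint_single sA _ Auv).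
exact: (@xgetPex _ 0 [set v | A (u, v)] (ex_intro _ v Auv)).
Qed.

End UnboundedOperators.

Section FiniteSupport.
Context {R : realType} {G : groupType}.
Local Notation H := (l2 R G).
Implicit Types (u a b : H) (g s r : G).

Lemma CGP u : CG u <-> exists2 S : seq G, uniq S & forall g, g \notin S -> u g = 0.
Proof.
split=> [fu|[S uS hS]].
  exists (fset_set [set g | u g != 0]) => [|g]; first exact: fset_uniq.
  by rewrite in_fset_set// notin_setE /= => /negP; rewrite negbK => /eqP.
apply: (@sub_finite_set _ _ [set` S]) => //.
by move=> g /=; apply: contraNT => /hS ->.
Qed.

Lemma fsbig_seqT (V : zmodType) (F : G -> V) (S : seq G) : uniq S ->
  (forall g, g \notin S -> F g = 0) -> \sum_(g \in [set: G]) F g = \sum_(g <- S) F g.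
Proof.
move=> uS hS; rewrite (fsbig_seq _ _ uS) -(@fsbig_widen _ _ _ _ [set` S] [set: G])//.
by move=> g [_ /= /negP gS]; apply: hS.
Qed.

Lemma lmulE (S : seq G) a u g : uniq S -> (forall s, s \notin S -> a s = 0) ->
  lmul a u g = \sum_(s <- S) a s * u (s^-1 * g)%g.
Proof.
move=> uS hS; rewrite /lmul (fsbig_seqT uS) => [|s /hS ->]; last by rewrite scale0r.
by rewrite l2sumE; apply: eq_bigr => s _; rewrite l2ZE lambdaE.
Qed.

Lemma rtransE u r g : (mkl2 (fun g => u (g * r^-1)%g) : H) g = u (g * r^-1)%g.
Proof. by rewrite (mkl2_inj (q := fun g => (g * r^-1)%g))//; exact: mulIg. Qed.

Lemma rmulE (S : seq G) u b g : uniq S -> (forall r, r \notin S -> b r = 0) ->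
  rmul u b g = \sum_(r <- S) b r * u (g * r^-1)%g.
Proof.
move=> uS hS; rewrite /rmul (fsbig_seqT uS) => [|r /hS ->]; last by rewrite scale0r.
by rewrite l2sumE; apply: eq_bigr => r _; rewrite l2ZE rtransE.
Qed.

Lemma CG_lmul a u : CG a -> CG u -> CG (lmul a u).
Proof.
move=> /CGP[S uS hS] /CGP[T uT hT]; apply/CGP.
exists (undup [seq (s * g)%g | s <- S, g <- T]); first exact: undup_uniq.
move=> g; rewrite mem_undup => gn; rewrite (lmulE _ _ uS hS) big_seq big1// => s sS.
rewrite hT ?mulr0//; apply: contra gn => gT; apply/allpairsP.
by exists (s, (s^-1 * g)%g); rewrite /= mulVKg.
Qed.

Lemma CG_rmul u b : CG u -> CG b -> CG (rmul u b).
Proof.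
move=> /CGP[T uT hT] /CGP[S uS hS]; apply/CGP.
exists (undup [seq (g * s)%g | g <- T, s <- S]); first exact: undup_uniq.
move=> g; rewrite mem_undup => gn; rewrite (rmulE _ _ uS hS) big_seq big1// => s sS.
rewrite hT ?mulr0//; apply: contra gn => gT; apply/allpairsP.
by exists ((g * s^-1)%g, s); rewrite /= mulgVK.
Qed.

Lemma lmul_basis s u g : lmul (basis s) u g = u (s^-1 * g)%g.
Proof.
rewrite (@lmulE [:: s])// => [|r]; first by rewrite big_seq1 basisE eqxx mul1r.
by rewrite inE basisE => /negPf ->.
Qed.

Lemma rmul_basis u r g : rmul u (basis r) g = u (g * r^-1)%g.
Proof.
rewrite (@rmulE [:: r])// => [|s]; first by rewrite big_seq1 basisE eqxx mul1r.
by rewrite inE basisE => /negPf ->.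
Qed.

Lemma lmul_basis2 s g : lmul (basis s) (basis g) = basis (s * g)%g :> H.
Proof.
by rewrite -lambda_basis; apply: l2P => h; rewrite lmul_basis lambdaE.
Qed.

Lemma rmul_basis2 g r : rmul (basis g) (basis r) = basis (g * r)%g :> H.
Proof.
apply: l2P => h; rewrite rmul_basis !basisE.
by rewrite (can2_eq (mulgVK r) (mulgK r)).
Qed.

(* The gradient of a Fourier multiplier with symbol [m] sends the basis vector
   at [g] to this multiple of the one at [s * g * r]; here [j = s * g * r]. *)
Definition gradient_coef (m : G -> R[i]) s r g : R[i] :=
  - (2^-1 : R[i]) * (m g + m (s^-1 * g * r^-1)%g - m (g * r^-1)%g - m (s^-1 * g)%g).

Lemma gradient_mapE (A : uop R G) a b u g : gradient_map A a b u g =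
  - (2^-1 : R[i]) * (app A (rmul (lmul a u) b) g + rmul (lmul a (app A u)) b g
    - rmul (app A (lmul a u)) b g - lmul a (app A (rmul u b)) g).
Proof. by rewrite /gradient_map l2ZE !(l2DE, l2NE). Qed.

(** Translations carry each of the four coordinates back to one of the form <A h, h>. This is how
    gradients of A, which need not be a multiplier, determine those of its diagonal. *)
Lemma gradient_map_diag (A : uop R G) s r g :
  gradient_map A (basis s) (basis r) (basis (s^-1 * g * r^-1)%g) g =
  gradient_coef (symbol A) s r g.
Proof.
rewrite gradient_mapE /gradient_coef; set k := (s^-1 * g * r^-1)%g.
have sk : (s * k = g * r^-1)%g by rewrite /k -mulgA mulVKg.
have kr : (k * r = s^-1 * g)%g by rewrite /k mulgVK.
have -> : app A (rmul (lmul (basis s) (basis k)) (basis r)) g = symbol A g.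
  by rewrite lmul_basis2 rmul_basis2 sk mulgVK.
have -> : rmul (lmul (basis s) (app A (basis k))) (basis r) g = symbol A k.
  by rewrite rmul_basis lmul_basis mulgA.
have -> : rmul (app A (lmul (basis s) (basis k))) (basis r) g = symbol A (g * r^-1)%g.
  by rewrite rmul_basis lmul_basis2 sk.
have -> : lmul (basis s) (app A (rmul (basis k) (basis r))) g = symbol A (s^-1 * g)%g.
  by rewrite lmul_basis rmul_basis2 kr.
by [].
Qed.

Lemma gradient_map_multiplier (A : uop R G) (m : G -> R[i]) (S T : seq G) a b u g :
  (forall w, CG w -> forall k, app A w k = m k * w k) ->
  uniq S -> (forall s, s \notin S -> a s = 0) ->
  uniq T -> (forall r, r \notin T -> b r = 0) -> CG u ->
  gradient_map A a b u g = \sum_(p <- [seq (s, r) | s <- S, r <- T])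
    a p.1 * b p.2 * (gradient_coef m p.1 p.2 g * u (p.1^-1 * g * p.2^-1)%g).
Proof.
move=> hm uS hS uT hT Cu.
(* All four terms become the same double sum over [S] and [T] with the summand [v s r]; only the
   argument of [m] differs. *)
have Ca : CG a by apply/CGP; exists S.
have Cb : CG b by apply/CGP; exists T.
pose v s r := a s * b r * u (s^-1 * g * r^-1)%g.
have -> : \sum_(p <- [seq (s, r) | s <- S, r <- T])
    a p.1 * b p.2 * (gradient_coef m p.1 p.2 g * u (p.1^-1 * g * p.2^-1)%g) =
    \sum_(s <- S) \sum_(r <- T) gradient_coef m s r g * v s r.
  rewrite big_allpairs_dep; apply: eq_bigr => s _; apply: eq_bigr => r _.
  by rewrite /v mulrCA.
rewrite gradient_mapE.
have -> : app A (rmul (lmul a u) b) g = \sum_(s <- S) \sum_(r <- T) m g * v s r.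
  rewrite (hm _ (CG_rmul (CG_lmul Ca Cu) Cb)) (rmulE _ _ uT hT) exchange_big mulr_sumr.
  apply: eq_bigr => r _; rewrite (lmulE _ _ uS hS) !mulr_sumr; apply: eq_bigr => s _.
  by rewrite /v mulgA; ring.
have -> : rmul (lmul a (app A u)) b g =
    \sum_(s <- S) \sum_(r <- T) m (s^-1 * g * r^-1)%g * v s r.
  rewrite (rmulE _ _ uT hT) exchange_big.
  apply: eq_bigr => r _; rewrite (lmulE _ _ uS hS) mulr_sumr; apply: eq_bigr => s _.
  by rewrite (hm _ Cu) /v mulgA; ring.
have -> : rmul (app A (lmul a u)) b g =
    \sum_(s <- S) \sum_(r <- T) m (g * r^-1)%g * v s r.
  rewrite (rmulE _ _ uT hT) exchange_big.
  apply: eq_bigr => r _; rewrite (hm _ (CG_lmul Ca Cu)) (lmulE _ _ uS hS) !mulr_sumr.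
  by apply: eq_bigr => s _; rewrite /v mulgA; ring.
have -> : lmul a (app A (rmul u b)) g =
    \sum_(s <- S) \sum_(r <- T) m (s^-1 * g)%g * v s r.
  rewrite (lmulE _ _ uS hS).
  apply: eq_bigr => s _; rewrite (hm _ (CG_rmul Cu Cb)) (rmulE _ _ uT hT) !mulr_sumr.
  by apply: eq_bigr => r _; rewrite /v; ring.
rewrite -big_split -!sumrB mulr_sumr; apply: eq_bigr => s _.
rewrite -big_split -!sumrB mulr_sumr; apply: eq_bigr => r _.
by rewrite /gradient_coef /=; ring.
Qed.

End FiniteSupport.

(** * Transfer of the gradient condition to the averaged generator *)

Section AveragedGradient.
Context {R : realType} {G : groupType}.
Local Notation H := (l2 R G).
Implicit Types (a b u : H) (g s r : G).

Lemma averaged_generator_app (E : op R (G * G)%type -> op R G) (Phi : R -> op R G -> op R G)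
    (A : uop R G) : averaging_expectation E -> is_qms Phi -> is_generator Phi A ->
  CG `<=` dom A -> positive_selfadjoint (averaged_generator E Phi) ->
  forall u, CG u -> dom (averaged_generator E Phi) u /\
    forall g, app (averaged_generator E Phi) u g = symbol A g * u g.
Proof.
move=> hE hPhi hA CGA sa u Cu; have /CGP[S uS hS] := Cu.
(* The pair (u, v) already lies in the graph before closure; single-valuedness of the closure then
   forces [app] to return [v]. *)
pose v : H := \sum_(g \in [set: G]) u g *: (symbol A g *: basis g).
have pre : averaged_generator E Phi (u, v).
  move=> e e0; exists u, v; rewrite !subrr l2norm0; split=> //.
  by split=> //; exists (fun g => symbol A g *: basis g); split=> // g; exact: averaged_limit.
split=> [|g]; first by exists v.
rewrite (app_unique sa pre) /v (fsbig_seqT uS) => [|k /hS ->]; last by rewrite scale0r.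
rewrite l2sumE; under eq_bigr do rewrite !l2ZE basisE.
have [gS|gS] := boolP (g \in S); last first.
  rewrite hS// mulr0 big_seq big1// => k kS; case: eqP => [e|]; last by rewrite !mulr0.
  by rewrite e kS in gS.
rewrite (bigD1_seq g)//= big1 => [|k kg]; first by rewrite eqxx mulr1 addr0 mulrC.
by rewrite eq_sym (negPf kg) !mulr0.
Qed.

(** The coefficients are entries of T along the bijection g |-> s^-1 g r^-1. As such they are
    bounded, tend to 0 off finite sets and, for finite p, are p-summable; this is what a weighted
    shift requires. *)
Lemma multiplier_gradient_schatten (p : \bar R) (m : G -> R[i]) (T : op R G) s r :
  (1%:E <= p)%E -> schatten p T ->
  (forall g, T (basis (s^-1 * g * r^-1)%g) g = gradient_coef m s r g) ->
  exists W : op R G, [/\ cpt W, forall p', p = p'%:E -> psum p' W &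
    forall u g, W u g = gradient_coef m s r g * u (s^-1 * g * r^-1)%g].
Proof.
move=> p1 sT hT.
pose q g := (s^-1 * g * r^-1)%g; pose q' g := (s * g * r)%g.
have qK : cancel q q' by move=> g; rewrite /q /q' !mulgA mulgV mul1g mulgVK.
have qi := can_inj qK.
pose c := gradient_coef m s r.
have cle g : cmod (c g) <= l2norm (T (basis (q g))) by rewrite /c -hT cmod_coord_le.
have [M M0 hM] := bounded_opP sT.1.
have cM g : cmod (c g) <= M.
  by rewrite (le_trans (cle g))// (le_trans (hM _))// l2norm_basis mulr1.
have c0 d : 0 < d -> exists F : seq G, forall g, g \notin F -> cmod (c g) <= d.
  move=> d0; have [F hF] := schatten_null p1 sT d0; exists (map q' F) => g gF.
  apply: le_trans (cle g) (hF _ _); apply: contra gF => gF.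
  by apply/mapP; exists (q g) => //; rewrite qK.
exists (wcomp c q); split=> [|p' pE|u g]; last exact: (wcompE qK cM).
  exact: (wcomp_cpt qK cM c0).
move: p1 sT; rewrite pE lee_fin => p1 sT.
have [C hC] := schatten_psum p1 sT.
apply: (wcomp_psum qK cM c0 p1 (C := C)) => S uS.
have := hC _ _ _ (orthosys_basis qi) (orthosys_basis (@inj_id G)) S uS.
by under eq_bigr do rewrite inner_basis hT.
Qed.

End AveragedGradient.

Theorem theorem3p15 (R : realType) (Gamma : groupType) (p : \bar R)
    (hp : (1%:E <= p)%E)
    (Phi : R -> op R Gamma -> op R Gamma) (hPhi : is_qms Phi)
    (Delta : uop R Gamma) (hDelta : is_generator Phi Delta)
    (hdom : CG `<=` dom Delta)
    (E : op R (Gamma * Gamma)%type -> op R Gamma)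
    (hE : averaging_expectation E)
    (Theta : R -> op R Gamma -> op R Gamma) (hTheta : is_qms Theta)
    (hDeltaPsi : is_generator Theta (averaged_generator E Phi)) :
  gradient_Sp p Phi -> gradient_Sp p Theta.
Proof.
(* The averaged generator is built from [E] and [Phi], so its symbol can be computed with this [A],
   the generator whose gradients are known to be in S_p. *)
move=> [A [hA CGA grad]].
have appE := averaged_generator_app hE hPhi hA CGA hDeltaPsi.1.
exists (averaged_generator E Phi); split=> // [u /appE[]//|a b Ca Cb].
have /choice[W hW] (k : Gamma * Gamma) : exists W : op R Gamma,
    [/\ cpt W, forall p', p = p'%:E -> psum p' W & forall u g,
      W u g = gradient_coef (symbol A) k.1 k.2 g * u (k.1^-1 * g * k.2^-1)%g].
  have [T [sT TE]] := grad _ _ (CG_basis k.1) (CG_basis k.2).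
  apply: (multiplier_gradient_schatten hp sT) => g.
  by rewrite TE ?gradient_map_diag//; exact: CG_basis.
have /CGP[S uS hS] := Ca; have /CGP[S' uS' hS'] := Cb.
pose t := [seq (s, r) | s <- S, r <- S'].
(* The gradient is bilinear in a and b, so the shifts for pairs of group elements combine with the
   coefficients of a and b. *)
exists (fun u => \sum_(k <- t) (a k.1 * b k.2) *: W k u); split.
  apply: cpt_schatten => // [|p' pE].
    by apply: cpt_sum => k; have [] := hW k.
  apply: psum_sum => [|k]; first by rewrite -lee_fin -pE.
  by have [_ + _] := hW k; apply.
move=> u Cu; apply: l2P => g.
rewrite (gradient_map_multiplier g (fun w Cw => (appE w Cw).2) uS hS uS' hS' Cu) l2sumE.
by apply: eq_bigr => k _; rewrite l2ZE; have [_ _ ->] := hW k.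
Qed.
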